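(* Let $d=1$, $\alpha\in(0,2]$, $t>0$, $x\in\mathbb R$. For $\varepsilon,\delta>0$ let $I^{\varepsilon,\delta}_{t,x}:=W(A^{\varepsilon,\delta}_{t,x})$. Then $I^{\varepsilon,\delta}_{t,x}$ converges in $L^2(\Omega)$ (with respect to the joint law of $W$ and $X$) as $(\varepsilon,\delta)\to 0$ to a limit $I_{t,x}$, denoted $I_{t,x}=\int_0^t\int_{\mathbb R}\delta(X^x_{t-r}-y)\,W(dr,dy)$. Moreover, conditionally on $X$, $I_{t,x}$ is a centered Gaussian random variable with variance $$\mathrm{Var}[I_{t,x}\mid X]=\int_0^t\int_0^t p_{|s-r|}(X_s-X_r)\,dr\,ds.$$
   Context: $p_t(x)=(2\pi t)^{-d/2}\exp(-|x|^2/(2t))$ is the heat kernel on $\mathbb R^d$. $X=\{X_t\}_{t\ge0}$ is a $d$-dimensional $\alpha$-stable process ($\alpha\in(0,2]$) started at $0$, whose density $g_\alpha(t,\cdot)$ has Fourier transform $\exp(-c_\alpha t|\xi|^\alpha)$ for some $c_\alpha>0$; $X^x_s:=X_s+x$. $\mathcal H$ is the completion of $C_c^\infty([0,\infty)\times\mathbb R^d)$ under the inner product $\langle f,g\rangle_{\mathcal H}=\int_{\mathbb R_+^2\times\mathbb R^{2d}} f(s,x)g(t,y)p_{|t-s|}(x-y)\,dx\,dy\,ds\,dt$, and $\{W(g),g\in\mathcal H\}$ is an isonormal Gaussian process with $\mathbb E[W(g)W(h)]=\langle g,h\rangle_{\mathcal H}$ (so formally $\mathbb E[\dot W(t,x)\dot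 W(s,y)]=p_{|t-s|}(x-y)$), independent of $X$. Let $\psi_\delta(t)=\delta^{-1}\mathbf 1_{[0,\delta]}(t)$ and $A^{\varepsilon,\delta}_{t,x}(r,y)=\int_0^t\psi_\delta(t-s-r)\,p_\varepsilon(X^x_s-y)\,ds$; conditionally on $X$, $A^{\varepsilon,\delta}_{t,x}\in\mathcal H$ a.s., so $W(A^{\varepsilon,\delta}_{t,x})$ is well defined. *)

(* Defs.v *)
From HB Require Import structures.
From mathcomp Require Import all_boot all_order all_algebra.
From mathcomp Require Import all_classical all_reals all_analysis.
Set Implicit Arguments. Unset Strict Implicit. Unset Printing Implicit Defensive.
Import Order.TTheory GRing.Theory Num.Def Num.Theory.
Import numFieldNormedType.Exports.
Local Open Scope classical_set_scope.
Local Open Scope ring_scope.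

Section defs.
Context {R : realType}.
Local Notation mu := (@lebesgue_measure R).

Definition heat (t z : R) : R :=
  (Num.sqrt (2 * pi * t))^-1 * expR (- (z ^+ 2) / (2 * t)).

Definition psi (delta u : R) : R := delta^-1 * \1_(`[0, delta]%classic) u.

Definition Hclass (f : R * R -> R) : Prop :=
  measurable_fun setT f /\
  (\int[mu]_(s in [set u : R | (0 <= u)%R]) \int[mu]_(r in [set u : R | (0 <= u)%R])
     \int[mu]_y \int[mu]_z
       (`|f (s, y)| * `|f (r, z)| * heat `|r - s| (y - z))%:E < +oo)%E.

Definition Hip (f g : R * R -> R) : R :=
  fine (\int[mu]_(s in [set u : R | (0 <= u)%R]) \int[mu]_(r in [set u : R | (0 <= u)%R])
     \int[mu]_y \int[mu]_z
       (f (s, y) * g (r, z) * heat `|r - s| (y - z))%:E)%E.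

Definition centered_gaussian d (T : measurableType d) (P : probability T R)
    (Y : T -> R) (v : R) : Prop :=
  0 <= v /\ measurable_fun setT Y /\
  forall B : set R, measurable B ->
    P (Y @^-1` B) = (if v == 0 then \d_(0 : R) B
                     else normal_prob 0 (Num.sqrt v) B).

(* Isonormal Gaussian process indexed by H (restricted to the functions of
   Hclass): a centered Gaussian family with covariance <.,.>_H, i.e. every
   finite linear combination is centered Gaussian with the right variance. *)
Definition isonormal d (T : measurableType d) (P : probability T R)
    (W : (R * R -> R) -> T -> R) : Prop :=
  forall (n : nat) (fs : 'I_n -> R * R -> R) (a : 'I_n -> R),
    (forall i, Hclass (fs i)) ->
    centered_gaussian P (fun w => \sum_(i < n) a i * W (fs i) w)
      (\sum_(i < n) \sum_(j < n) a i * a j * Hip (fs i) (fs j)).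

Definition indep_increments d (T : measurableType d) (P : probability T R)
    (X : R -> T -> R) : Prop :=
  forall (n : nat) (ts : nat -> R) (B : nat -> set R),
    0 <= ts 0%N -> (forall i, (i < n)%N -> ts i < ts i.+1) ->
    (forall i, measurable (B i)) ->
    P (\bigcap_(i in `I_n) [set w | B i (X (ts i.+1) w - X (ts i) w)]) =
    (\prod_(i < n) P [set w | B i (X (ts i.+1) w - X (ts i) w)%R])%E.

(* X is a one-dimensional alpha-stable (Levy) process started at 0:
   cadlag paths, independent increments, and X_t - X_s has density
   g(t-s, .) whose Fourier transform is exp(-c (t-s) |xi|^alpha). *)
Definition stable_process d (T : measurableType d) (P : probability T R)
    (X : R -> T -> R) (alpha c : R) : Prop :=
  (forall s, measurable_fun setT (X s)) /\
  (forall w, X 0 w = 0) /\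
  (forall w s, 0 <= s -> (fun u => X u w) @ at_right s --> X s w) /\
  (forall w s, 0 < s -> cvg ((fun u => X u w) @ at_left s)) /\
  indep_increments P X /\
  exists g : R -> R -> R,
    forall s r, 0 <= s -> s < r ->
      measurable_fun setT (g (r - s)) /\ (forall y, 0 <= g (r - s) y) /\
      (forall B, measurable B ->
         P [set w | B (X r w - X s w)] = (\int[mu]_(y in B) (g (r - s) y)%:E)%E) /\
      (forall xi : R,
         (\int[mu]_y (g (r - s) y * cos (xi * y))%:E)%E
           = (expR (- (c * (r - s) * powR `|xi| alpha)))%:E /\
         (\int[mu]_y (g (r - s) y * sin (xi * y))%:E)%E = 0%E).

Definition Afun d (T : measurableType d) (X : R -> T -> R)
    (eps delta t x : R) (w : T) : R * R -> R :=
  fun ry => Rintegral mu `[0, t]%classic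
    (fun s => psi delta (t - s - ry.1) * heat eps (X s w + x - ry.2)).

End defs.

(* Main.v *)
(* In dimension one the heat kernel satisfies p_t(z) <= t^(-1/2), and |a - b|^(-1/2) is
   integrable near the diagonal, so that all the estimates are deterministic: they hold
   for every measurable path. By the semigroup property, the inner product of
   A^{e,d} and A^{e',d'} is the average of p_{e+e'+|r-s|}(X_a - X_b) for weights that
   force |r-s| to be within d + d' of |a-b|. A Lipschitz estimate of the heat kernel in
   time away from 0, with the integrable singularity near 0, shows that this average
   tends to the energy int int p_{|a-b|}(X_a - X_b) uniformly in the path. Hence W(A) is
   Cauchy in L^2(W) uniformly in X. A fast subsequence converges almost surely for every
   fixed X; its limsup is the jointly measurable limit I; Fatou and Tonelli give the
   L^2 convergence on the product space, and conditionally on X the limit is Gaussian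
   because L^2 limits of centered Gaussians with converging variances are Gaussian. *)

Require Import Defs.
From HB Require Import structures.
From mathcomp Require Import all_boot all_order all_algebra.
From mathcomp Require Import all_classical all_reals all_analysis.
From mathcomp Require Import measurable_realfun ring lra.
Import Order.TTheory GRing.Theory Num.Def Num.Theory.
Import numFieldNormedType.Exports.
Set Implicit Arguments. Unset Strict Implicit. Unset Printing Implicit Defensive.
Local Open Scope classical_set_scope.
Local Open Scope ring_scope.

(** * Heat kernel: bounds, semigroup property, regularity in time *)

Section heat_kernel.
Context {R : realType}.
Implicit Types t s z a eta rho : R.
Local Notation mu := (@lebesgue_measure R).

(** Two defects of the approximation shape the statements. With [heat 0 z = 0], the kernel of the
    inner product vanishes where the two noise times coincide, while the limiting kernel can be
    positive there. Rather than discarding null sets, the error term is [+oo] at such points, so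
    that all comparisons are pointwise in [\bar R], with errors added on the right and nothing
    subtracted. The second defect comes from the one-sided mollifier: noise times are nonnegative,
    so for path times within [delta] of [t] part of the mass of [psi] is cut off. The lost strip
    carries energy of order [delta]. Uniformity in the path is what produces a function on the
    product space: the scales of the fast subsequence are chosen before the path, so one sequence
    serves every path. Gaussianity of the limit is read off distribution functions, from three
    estimates: Chebyshev, the Lipschitz bound for a Gaussian distribution function, and continuity
    in total variation with respect to the variance. A crude second moment [8 * v] is enough
    throughout. *)

Lemma heat0 z : heat 0 z = 0.
Proof. by rewrite /heat mulr0 sqrtr0 invr0 mul0r. Qed.

Lemma heat_ge0 t z : 0 <= heat t z.
Proof. by rewrite /heat mulr_ge0 ?invr_ge0 ?sqrtr_ge0 ?expR_ge0. Qed.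

Lemma heatN t z : heat t (- z) = heat t z.
Proof. by rewrite /heat sqrrN. Qed.

Lemma measurable_sqrt : measurable_fun setT (@Num.sqrt R).
Proof. by apply: continuous_measurable_fun; exact: sqrt_continuous. Qed.

Lemma measurable_inv : measurable_fun setT (@GRing.inv R).
Proof.
rewrite (_ : GRing.inv = fun x : R => if x == 0 then 0 else x^-1); last first.
  by apply/funext => x; case: eqP => // ->; rewrite invr0.
apply: measurable_fun_if => //=.
  apply: (measurable_fun_bool true).
  rewrite (_ : _ @^-1` _ = [set 0]); first by rewrite setTI; exact: measurable_set1.
  by apply/seteqP; split => x /= => [/eqP//|->]; rewrite eqxx.
rewrite setTI (_ : _ @^-1` _ = ~` [set 0]); last first.
  by apply/seteqP; split => x /= => [/negbT/eqP//|/eqP/negbTE].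
apply: open_continuous_measurable_fun.
  by apply: closed_openC; exact: closed_eq.
by move=> x; rewrite inE => /= /eqP x0; exact: inv_continuous.
Qed.

Lemma measurable_heat : measurable_fun setT (fun p : R * R => heat p.1 p.2).
Proof.
rewrite /heat; apply: measurable_funM.
  apply: (measurableT_comp measurable_inv).
  apply: (measurableT_comp measurable_sqrt).
  exact: measurable_funM.
apply: measurableT_comp => //; apply: measurable_funM.
  by apply: measurableT_comp => //; exact: measurable_funX.
apply: (measurableT_comp measurable_inv).
exact: measurable_funM.
Qed.

Lemma measurable_heat_comp d (T : measurableType d) (f g : T -> R) :
  measurable_fun setT f -> measurable_fun setT g ->
  measurable_fun setT (fun x => heat (f x) (g x)).
Proof.
move=> mf mg.
by apply: (measurableT_comp measurable_heat (g := fun x => (f x, g x)));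
  exact: measurable_fun_pair.
Qed.

Lemma heatE t z : 0 < t -> heat t z = normal_pdf 0 (Num.sqrt t) z.
Proof.
move=> t0; rewrite normal_pdfE ?gt_eqF ?sqrtr_gt0//.
rewrite /heat /normal_peak /normal_fun sqr_sqrtr ?ltW// subr0.
by congr (_^-1 * expR (_ / _)); [congr Num.sqrt|]; rewrite -mulr_natl; ring.
Qed.

Lemma le_sqrtV s t : 0 < s -> s <= t -> (Num.sqrt t)^-1 <= (Num.sqrt s)^-1.
Proof.
move=> s0 st; have t0 := lt_le_trans s0 st.
by rewrite lef_pV2 ?posrE ?sqrtr_gt0// ler_sqrt// ltW.
Qed.

(** The exponential is at most 1 and [2 * pi] at least 1. For [t <= 0] both sides are 0, because the
    square root of a nonpositive number and the inverse of 0 are both 0. *)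
Lemma heat_le t z : heat t z <= (Num.sqrt t)^-1.
Proof.
have [t0|t0] := leP t 0.
  by rewrite /heat ler0_sqrtr ?invr0 ?mul0r ?ler0_sqrtr ?invr0// pmulr_rle0// mulr_gt0// pi_gt0.
rewrite /heat -[leRHS]mulr1 ler_pM ?invr_ge0 ?sqrtr_ge0 ?expR_ge0//.
  apply: le_sqrtV => //; rewrite ler_peMl ?(ltW t0)//.
  have := @pi_ge2 R; lra.
rewrite -[X in _ <= X]expR0 ler_expR mulNr oppr_le0 divr_ge0 ?sqr_ge0// mulr_ge0// ltW//.
Qed.

(** Completing the square in [y] factors the integrand as [heat (s + t) (a - z)] times the normal
    density with mean [m] and variance [v], which has mass 1. *)
Lemma heat_conv s t a z : 0 < s -> 0 < t ->
  (\int[mu]_y (heat s (a - y) * heat t (y - z))%:E = (heat (s + t) (a - z))%:E)%E.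
Proof.
move=> s0 t0; have st0 : 0 < s + t by rewrite addr_gt0.
pose v := s * t / (s + t); pose m := (t * a + s * z) / (s + t).
have v0 : 0 < v by rewrite divr_gt0 ?mulr_gt0.
have E y : heat s (a - y) * heat t (y - z) = heat (s + t) (a - z) * normal_pdf m (Num.sqrt v) y.
  rewrite normal_pdfE ?gt_eqF ?sqrtr_gt0// /heat /normal_peak /normal_fun.
  rewrite sqr_sqrtr ?(ltW v0)// mulrACA -expRD [RHS]mulrACA -expRD; congr (_ * expR _).
    have pi0 := @pi_gt0 R.
    rewrite -!invfM -!sqrtrM ?mulr_ge0 ?ltW//; congr (Num.sqrt _)^-1.
    by rewrite /v -mulr_natl; field; rewrite gt_eqF.
  rewrite /v /m -mulr_natl; field.
  by rewrite (gt_eqF st0) (gt_eqF t0) (gt_eqF s0).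
under eq_integral do rewrite E EFinM.
rewrite ge0_integralZl ?integral_normal_pdf ?mule1 ?lee_fin ?heat_ge0//.
  by apply/measurable_EFinP; exact: measurable_normal_pdf.
by move=> x _; rewrite lee_fin normal_pdf_ge0.
Qed.

(** If [s <= t], the exponential is smaller at time [s], so only the prefactors differ, and the
    difference of square roots is at most [(t - s) / Num.sqrt t]. If [t < s], the prefactor is
    smaller at [s] and only the exponentials have to be compared. *)
Lemma heat_time_lip s t z : 0 < s -> 0 < t ->
  heat s z <= heat t z + (Num.sqrt s)^-1 * (`|s - t| / t).
Proof.
move=> s0 t0.
have p0 : 0 < Num.sqrt (2 * pi : R) by rewrite sqrtr_gt0 mulr_gt0 ?pi_gt0.
have p1 : (Num.sqrt (2 * pi : R))^-1 <= 1.
  rewrite invf_le1// -[leLHS]sqrtr1 ler_sqrt ?mulr_ge0 ?pi_ge0//.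
  have := @pi_ge2 R; lra.
have hE u : 0 < u -> heat u z = (Num.sqrt (2 * pi : R))^-1 *
    ((Num.sqrt u)^-1 * expR (- (z ^+ 2 / (2 * u)))).
  move=> u0; rewrite /heat sqrtrM ?mulr_ge0 ?ltW ?pi_gt0//.
  by rewrite invfM -mulrA mulNr.
suff: (Num.sqrt s)^-1 * expR (- (z ^+ 2 / (2 * s))) -
    (Num.sqrt t)^-1 * expR (- (z ^+ 2 / (2 * t))) <= (Num.sqrt s)^-1 * (`|s - t| / t).
  move=> le; rewrite -lerBlDl !hE// -mulrBr.
  have B0 : 0 <= (Num.sqrt s)^-1 * (`|s - t| / t).
    by rewrite mulr_ge0 ?invr_ge0 ?sqrtr_ge0// divr_ge0 ?(ltW t0).
  apply: (le_trans (ler_wpM2l _ le)); first by rewrite invr_ge0 sqrtr_ge0.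
  by rewrite ler_piMl.
have ss0 : 0 < Num.sqrt s by rewrite sqrtr_gt0.
have st0 : 0 < Num.sqrt t by rewrite sqrtr_gt0.
have [st|ts] := leP s t.
  have e1 : expR (- (z ^+ 2 / (2 * s))) <= expR (- (z ^+ 2 / (2 * t))).
    rewrite ler_expR lerN2 ler_wpM2l ?sqr_ge0// lef_pV2 ?posrE ?mulr_gt0//.
    by rewrite ler_pM2l.
  have e2 : expR (- (z ^+ 2 / (2 * s))) <= 1.
    by rewrite -[X in _ <= X]expR0 ler_expR oppr_le0 divr_ge0 ?sqr_ge0 ?mulr_ge0 ?ltW.
  have e0 := expR_gt0 (- (z ^+ 2 / (2 * s))).
  set E := expR (- (z ^+ 2 / (2 * s))) in e1 e2 e0 *.
  apply: (@le_trans _ _ (((Num.sqrt s)^-1 - (Num.sqrt t)^-1) * E)).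
    by rewrite mulrBl lerD2l lerN2 ler_wpM2l// invr_ge0 ltW.
  have d0 : (Num.sqrt t)^-1 <= (Num.sqrt s)^-1.
    exact: le_sqrtV.
  apply: (@le_trans _ _ ((Num.sqrt s)^-1 - (Num.sqrt t)^-1)).
    by rewrite ler_piMr// subr_ge0.
  have -> : (Num.sqrt s)^-1 - (Num.sqrt t)^-1 =
      (Num.sqrt s)^-1 * ((Num.sqrt t - Num.sqrt s) / Num.sqrt t).
    by field; rewrite !gt_eqF.
  apply: ler_wpM2l; first by rewrite invr_ge0 ltW.
  rewrite ler_pdivrMr// -{3}(sqr_sqrtr (ltW t0)) distrC ger0_norm ?subr_ge0//.
  rewrite -{2}(sqr_sqrtr (ltW t0)) -{2}(sqr_sqrtr (ltW s0)).
  set x := Num.sqrt s in ss0 *; set y := Num.sqrt t in st0 *.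
  have -> : (y ^+ 2 - x ^+ 2) / y ^+ 2 * y = (y - x) * (y + x) / y.
    by field; rewrite gt_eqF.
  have xy : x <= y by rewrite /x /y ler_sqrt// ltW.
  by rewrite ler_pdivlMr// ler_wpM2l ?lerDl ?subr_ge0// ltW.
rewrite gtr0_norm ?subr_gt0//.
apply: (@le_trans _ _ ((Num.sqrt s)^-1 *
   (expR (- (z ^+ 2 / (2 * s))) - expR (- (z ^+ 2 / (2 * t)))))).
  rewrite mulrBr lerD2l lerN2 ler_wpM2r ?expR_ge0//.
  exact: (le_sqrtV t0 (ltW ts)).
apply: ler_wpM2l; first by rewrite invr_ge0 ltW.
(* The exponent at time [t] is [q + q * w], with [w] the relative time gap. Then
   [1 - expR (- (q * w)) <= q * w], and [q * expR (- q) <= 1] removes the dependence on [z]. *)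
set q := z ^+ 2 / (2 * s).
have q0 : 0 <= q by rewrite divr_ge0 ?sqr_ge0 ?mulr_ge0 ?ltW.
have -> : z ^+ 2 / (2 * t) = q + q * ((s - t) / t).
  by rewrite /q; field; rewrite !gt_eqF.
set w := (s - t) / t; have w0 : 0 <= w by rewrite divr_ge0 ?subr_ge0 ?(ltW ts) ?(ltW t0).
rewrite opprD expRD -{1}[expR (- q)]mulr1 -mulrBr.
have := expR_ge1Dx (- (q * w)) => h1.
have h2 : expR (- q) * q <= 1.
  rewrite expRN ler_pdivrMl ?expR_gt0// mulr1.
  have := expR_ge1Dx q; lra.
apply: (@le_trans _ _ (expR (- q) * (q * w))).
  by rewrite ler_wpM2l ?expR_ge0//; lra.
by rewrite mulrA -[leRHS]mul1r ler_wpM2r.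
Qed.

(* An integrable majorant of [heat t] for small [t]. The value [+oo] at [0], where [heat]
   has the junk value [0], makes the comparisons below hold everywhere. *)
Definition sing rho t : \bar R :=
  if t == 0 then +oo%E else if `|t| < rho then ((Num.sqrt `|t|)^-1)%:E else 0%E.

Lemma sing_ge0 rho t : (0 <= sing rho t)%E.
Proof.
by rewrite /sing; case: ifP => // _; case: ifP => // _; rewrite lee_fin invr_ge0 sqrtr_ge0.
Qed.

Lemma sing_norm rho t : sing rho `|t| = sing rho t.
Proof. by rewrite /sing normr_eq0 normr_id. Qed.

Lemma singN rho t : sing rho (- t) = sing rho t.
Proof. by rewrite -sing_norm normrN sing_norm. Qed.

Lemma le_sing rho s t : `|s| <= `|t| -> (sing rho t <= sing rho s)%E.
Proof.
rewrite /sing; have [->|s0 st] := eqVneq s 0; first by rewrite leey.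
have t0 : 0 < `|t| by rewrite (lt_le_trans _ st)// normr_gt0.
rewrite -normr_eq0 gt_eqF//; case: ltP => [tr|_]; last first.
  by have := sing_ge0 rho s; rewrite /sing (negbTE s0).
by rewrite (le_lt_trans st tr) lee_fin le_sqrtV// normr_gt0.
Qed.

Lemma measurable_sing rho : measurable_fun setT (sing rho).
Proof.
rewrite /sing; apply: measurable_fun_ifT => //.
  by apply: measurable_fun_eqr.
apply: measurable_fun_ifT => //.
  by apply: measurable_fun_ltr => //; exact: normr_measurable.
apply/measurable_EFinP; apply: (measurableT_comp measurable_inv).
by apply: (measurableT_comp measurable_sqrt); exact: normr_measurable.
Qed.

Lemma heat_le_sing rho t z : 0 <= t < rho -> ((heat t z)%:E <= sing rho t)%E.
Proof.
move=> /andP[t0 tr]; rewrite /sing; case: ifP => [_|_]; first by rewrite leey.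
by rewrite ger0_norm// tr lee_fin heat_le.
Qed.

(** When both times are at least [rho], the Lipschitz estimate gives the first error term. When
    [s < rho], [sing rho s] already dominates the left side; when [t < rho <= s], [sing rho t] does,
    since the inverse square root decreases. At [s = 0] the left side is 0, at [t = 0] the right
    side is [+oo]. *)
Lemma heat_time_diff s t z eta rho : 0 <= s -> 0 <= t -> 0 < rho -> `|s - t| <= eta ->
  ((heat s z)%:E <= (heat t z)%:E + ((eta / (rho * Num.sqrt rho))%:E
     + sing rho s + sing rho t))%E.
Proof.
rewrite le_eqVlt => /predU1P[<- t0 r0 e0|s0].
  by rewrite heat0 !adde_ge0 ?lee_fin ?heat_ge0 ?sing_ge0// divr_ge0 ?mulr_ge0 ?sqrtr_ge0 ?(le_trans _ e0)// ltW.
rewrite le_eqVlt => /predU1P[<- r0 e0|t0 r0 ste].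
  have s1 : sing rho s != -oo%E by rewrite gt_eqF// (lt_le_trans _ (sing_ge0 _ _)).
  by rewrite [sing _ 0]/sing eqxx addey ?addey ?leey//; case: sing s1.
have eta0 : 0 <= eta by rewrite (le_trans _ ste).
have sr0 : 0 < Num.sqrt rho by rewrite sqrtr_gt0.
have e0 : 0 <= eta / (rho * Num.sqrt rho).
  by rewrite divr_ge0// mulr_ge0// ltW.
have ht := heat_ge0 t z; have hs := heat_le s z.
have sv (u : R) : 0 <= (Num.sqrt u)^-1 by rewrite invr_ge0 sqrtr_ge0.
have si := le_sqrtV.
rewrite /sing !gt_eqF// !gtr0_norm//.
have := sv t; have := sv s; have := si s t s0; have := si t s t0; move: si => _.
case: ltP => sr; case: ltP => tr; rewrite -!EFinD lee_fin => h1 h2 h3 h4; try lra.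
apply: (le_trans (heat_time_lip z s0 t0)); rewrite lerD2l !addr0.
apply: (@le_trans _ _ ((Num.sqrt rho)^-1 * (eta / rho))).
  apply: ler_pM => //; first by rewrite divr_ge0// ltW.
    exact: le_sqrtV.
  by rewrite ler_pM// ?invr_ge0 ?(ltW t0)// lef_pV2.
by rewrite le_eqVlt; apply/orP; left; apply/eqP; field; rewrite !gt_eqF.
Qed.

End heat_kernel.

(** * Integral of the singular majorant, and Tonelli for iterated integrals *)

Section sing_integral.
Context {R : realType}.
Local Notation mu := (@lebesgue_measure R).

Lemma lebesgue_measureD (a : R) (A : set R) : measurable A ->
  pushforward mu (fun x : R => (a + x : measurableTypeR R)) A = mu A.
Proof.
have ma : measurable_fun setT (fun x : measurableTypeR R => (a + x : measurableTypeR R)).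
  exact: measurable_funD.
move=> mA; apply/esym/lebesgue_measure_unique => //= _ [[b c]] _ <-.
rewrite /pushforward/= (_ : _ @^-1` _ = `]b - a, c - a]%classic); last first.
  by apply/seteqP; split => x/=; rewrite !in_itv/= ltrBlDl lerBrDl.
rewrite !lebesgue_measure_itv/= !lte_fin ltrD2r -!EFinB.
by have -> : c - a - (b - a) = c - b by ring.
Qed.

Lemma ge0_integral_shift (a : R) (f : R -> \bar R) :
  measurable_fun setT f -> (forall x, (0 <= f x)%E) ->
  (\int[mu]_x f (a + x)%R = \int[mu]_x f x)%E.
Proof.
move=> mf f0.
have ma : measurable_fun setT (fun x : measurableTypeR R => (a + x : measurableTypeR R)).
  exact: measurable_funD.
rewrite -(@ge0_integral_pushforward _ _ (measurableTypeR R) (measurableTypeR R) R _ ma mu setT f)//.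
  by apply: eq_measure_integral => //= A mA _; exact: lebesgue_measureD.
Qed.

Lemma ge0_integral_opp (f : R -> \bar R) :
  measurable_fun setT f -> (forall x, (0 <= f x)%E) ->
  (\int[mu]_x f (- x)%R = \int[mu]_x f x)%E.
Proof.
move=> mf f0.
have ma : measurable_fun setT (fun x : measurableTypeR R => (- x : measurableTypeR R)).
  exact: oppr_measurable.
rewrite -(@ge0_integral_pushforward _ _ (measurableTypeR R) (measurableTypeR R) R _ ma mu setT f)//.
by apply: eq_measure_integral => //= A mA _; exact: lebesgue_measureN.
Qed.

Lemma integral_sqrtV (a b : R) : 0 < a -> a < b ->
  (\int[mu]_(x in `[a, b]) ((Num.sqrt x)^-1)%:E <= (2 * Num.sqrt b)%:E)%E.
Proof.
move=> a0 ab.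
have dF x : 0 < x -> derivable (fun x : R => 2 * Num.sqrt x) x 1.
  move=> x0; apply: derivableM => //.
  by have [] := @is_derive1_sqrt R x x0.
have cF x : 0 < x -> {for x, continuous (fun x : R => 2 * Num.sqrt x)}.
  by move=> x0; apply/differentiable_continuous/derivable1_diffP; exact: dF.
rewrite (@continuous_FTC2 _ _ (fun x => 2 * Num.sqrt x))//.
- by rewrite -EFinB lee_fin gerBl mulr_ge0// sqrtr_ge0.
- apply: continuous_in_subspaceT => x; rewrite inE/= in_itv/= => /andP[ax _].
  have x0 := lt_le_trans a0 ax.
  apply: (@continuousV _ _ _ x); first by rewrite gt_eqF// sqrtr_gt0.
  exact: sqrt_continuous.
- split.
  + by move=> x; rewrite in_itv/= => /andP[ax _]; apply: dF; exact: lt_trans ax.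
  + by apply: cvg_at_right_filter; exact: cF.
  + by apply: cvg_at_left_filter; apply: cF; exact: lt_trans ab.
- move=> x; rewrite in_itv/= => /andP[ax _]; have x0 := lt_trans a0 ax.
  rewrite derive1E deriveM//; last by have [] := @is_derive1_sqrt R x x0.
  rewrite derive_cst scaler0 addr0 derive_sqrt// /GRing.scale/=.
  by rewrite invfM mulrA mulfV// mul1r.
Qed.

Lemma integral_sing (rho : R) : 0 < rho ->
  (\int[mu]_x sing rho x <= (4 * Num.sqrt rho)%:E)%E.
Proof.
move=> r0.
have msing := @measurable_sing R rho.
have msqrtV : measurable_fun setT (fun x : R => ((Num.sqrt x)^-1)%:E).
  apply/measurable_EFinP; apply: (measurableT_comp measurable_inv).
  exact: measurable_sqrt.
have sV0 (x : R) : (0 <= ((Num.sqrt x)^-1)%:E)%E by rewrite lee_fin invr_ge0 sqrtr_ge0.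
pose g := (fun x : R => ((Num.sqrt x)^-1)%:E) \_ `]0, rho].
have mg : measurable_fun setT g.
  by apply/(measurable_restrictT _ _).1 => //; exact: measurable_funTS.
have g0 x : (0 <= g x)%E by apply: erestrict_ge0.
have intg : (\int[mu]_x g x <= (2 * Num.sqrt rho)%:E)%E.
  rewrite -integral_mkcond.
  (* The fundamental theorem of calculus is applied away from the singularity, then monotone
     convergence fills []0, rho]]. The index shift by 2 makes the left endpoint strictly smaller
     than [rho] already for [i = 0]. *)
  pose F (i : nat) : set R := `[rho / i.+2%:R, rho]%classic.
  have -> : `]0, rho]%classic = \bigcup_i F i.
    apply/seteqP; split => x /=; rewrite ?in_itv/=.
      move=> /andP[x0 xr]; exists (truncn (rho / x)) => //=.
      rewrite /F/= in_itv/= xr andbT ler_pdivrMr// mulrC -ler_pdivrMr//.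
      by rewrite (le_trans (ltW (truncnS_gt _)))// ler_nat.
    move=> [i _]; rewrite /F/= in_itv/= => /andP[ix ->]; rewrite andbT.
    by rewrite (lt_le_trans _ ix)// divr_gt0.
  have ndF : nondecreasing_seq F.
    move=> m n mn; apply/subsetPset => x; rewrite /F/= !in_itv/= => /andP[+ ->].
    rewrite andbT; apply: le_trans; rewrite ler_wpM2l ?(ltW r0)//.
    by rewrite lef_pV2 ?posrE// ler_nat.
  have cv := @ge0_nondecreasing_set_cvg_integral _ (measurableTypeR R) R F
    (fun x => ((Num.sqrt x)^-1)%:E) mu ndF (fun=> measurable_itv _)
    (fun=> measurable_funTS msqrtV) (fun i x _ => sV0 x).
  rewrite -(cvg_lim _ cv)//; apply: lime_le; first by apply/cvg_ex; eexists; exact: cv.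
  apply: nearW => n; apply: integral_sqrtV; first by rewrite divr_gt0.
  by rewrite ltr_pdivrMr// ltr_pMr// ltr1n.
have mgN : measurable_fun setT (fun x : R => g (- x)).
  by apply: measurableT_comp => //; exact: oppr_measurable.
(* The value [+oo] at 0 sits on a null set. Off it, [sing rho] is bounded by [g] plus its
   reflection, whence twice [2 * Num.sqrt rho]. *)
rewrite -(@integral_setD1 R (sing rho) 0 setT).
apply: (@le_trans _ _ (\int[mu]_(x in setT `\ 0%R) (g x + g (- x)%R))%E).
  apply: ge0_le_integral => //.
  - exact: measurableD.
  - by move=> x _; exact: sing_ge0.
  - exact: measurable_funTS.
  - apply: measurable_funTS; exact: emeasurable_funD.
  - move=> x [_ /= /eqP x0]; rewrite /sing (negbTE x0); case: ltP => xr; last first.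
      by rewrite adde_ge0.
    have [xp|xn] := leP 0 x.
      rewrite ger0_norm// in xr *; rewrite [g x]/patch mem_set/=; last first.
        by rewrite in_itv/= (ltW xr) lt_neqAle eq_sym x0 xp.
      by rewrite leeDl.
    rewrite ltr0_norm// in xr *; rewrite [g (- x)]/patch mem_set/=; last first.
      by rewrite in_itv/= (ltW xr) oppr_gt0 xn.
    by rewrite leeDr.
apply: (@le_trans _ _ (\int[mu]_x (g x + g (- x)%R))%E).
  apply: ge0_subset_integral => //; first exact: measurableD.
    exact: emeasurable_funD.
  by move=> x _; rewrite adde_ge0.
- rewrite ge0_integralD// ge0_integral_opp//.
  have -> : (4 * Num.sqrt rho)%:E = ((2 * Num.sqrt rho)%:E + (2 * Num.sqrt rho)%:E)%E.
    by rewrite -EFinD; congr EFin; ring.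
  exact: leeD.
- exact: measurableD.
- exact: measurable_funTS.
Qed.

Lemma integral_sing_shift (rho a : R) : 0 < rho ->
  (\int[mu]_x sing rho (a - x)%R <= (4 * Num.sqrt rho)%:E)%E.
Proof.
move=> r0; have ms := @measurable_sing R rho.
rewrite (ge0_integral_opp (f := fun x => sing rho (a + x)%R)).
- by rewrite ge0_integral_shift ?integral_sing//; exact: sing_ge0.
- by apply: measurableT_comp => //; exact: measurable_funD.
- by move=> x; exact: sing_ge0.
Qed.

Lemma tonelliR (f : R * R -> \bar R) :
  measurable_fun setT f -> (forall p, (0 <= f p)%E) ->
  (\int[mu]_x \int[mu]_y f (x, y) = \int[mu]_y \int[mu]_x f (x, y))%E.
Proof.
move=> mf f0.
exact: (@fubini_tonelli _ _ (measurableTypeR R) (measurableTypeR R) R mu mu f mf f0).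
Qed.

Lemma measurable_integral_pair d (T : measurableType d) (f : T * R -> \bar R) :
  measurable_fun setT f -> (forall p, (0 <= f p)%E) ->
  measurable_fun setT (fun x => \int[mu]_y f (x, y))%E.
Proof.
move=> mf f0.
exact: (@measurable_fun_fubini_tonelli_F _ _ T (measurableTypeR R) R mu f mf f0).
Qed.

(** The inner product puts the noise times [s], [r] outermost; the estimates need each path time
    ([a], [b]) directly followed by its own noise time. *)
Lemma integral_quadruple (F : R -> R -> R -> R -> \bar R) :
  measurable_fun setT (fun p : (R * R) * (R * R) => F p.1.1 p.1.2 p.2.1 p.2.2) ->
  (forall a s b r, (0 <= F a s b r)%E) ->
  (\int[mu]_s \int[mu]_r \int[mu]_b \int[mu]_a F a s b r =
   \int[mu]_a \int[mu]_s \int[mu]_b \int[mu]_r F a s b r)%E.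
Proof.
move=> mF F0.
have mF' d (T : measurableType d) (fa fs fb fr : T -> R) :
    measurable_fun setT fa -> measurable_fun setT fs ->
    measurable_fun setT fb -> measurable_fun setT fr ->
    measurable_fun setT (fun x => F (fa x) (fs x) (fb x) (fr x)).
  move=> ma ms mb mr.
  apply: (measurableT_comp mF (g := fun x => ((fa x, fs x), (fb x, fr x)))).
  by apply: measurable_fun_pair; exact: measurable_fun_pair.
have mf1 d1 d2 (T1 : measurableType d1) (T2 : measurableType d2) :
  measurable_fun setT (fun x : T1 * T2 => x.1) by exact: measurable_fst.
have mf2 d1 d2 (T1 : measurableType d1) (T2 : measurableType d2) :
  measurable_fun setT (fun x : T1 * T2 => x.2) by exact: measurable_snd.
have m11 : measurable_fun setT (fun x : (R * R) * R => x.1.1).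
  by apply: measurableT_comp.
have m12 : measurable_fun setT (fun x : (R * R) * R => x.1.2).
  by apply: measurableT_comp.
transitivity (\int[mu]_s \int[mu]_a \int[mu]_b \int[mu]_r F a s b r)%E; last first.
  apply: (tonelliR (f := fun p => \int[mu]_b \int[mu]_r F p.2 p.1 b r)%E).
    apply: (measurable_integral_pair (T := (R * R)%type)
      (f := fun p => \int[mu]_r F p.1.2 p.1.1 p.2 r)%E).
      apply: (measurable_integral_pair (T := ((R * R) * R)%type)
        (f := fun p => F p.1.1.2 p.1.1.1 p.1.2 p.2)%E) => //.
      apply: mF' => //.
      + by apply: (measurableT_comp m12).
      + by apply: (measurableT_comp m11).
      + by apply: measurableT_comp.
    by move=> p; exact: integral_ge0.
  by move=> p; apply: integral_ge0 => b _; exact: integral_ge0.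
apply: eq_integral => s _.
rewrite (tonelliR (f := fun p => \int[mu]_a F a s p.2 p.1)%E); last 2 first.
- apply: (measurable_integral_pair (T := (R * R)%type)
    (f := fun p => F p.2 s p.1.2 p.1.1)%E) => //.
  exact: mF'.
- by move=> p; exact: integral_ge0.
rewrite (tonelliR (f := fun p => \int[mu]_r F p.1 s p.2 r)%E); last 2 first.
- apply: (measurable_integral_pair (T := (R * R)%type)
    (f := fun p => F p.1.1 s p.1.2 p.2)%E) => //.
  exact: mF'.
- by move=> p; exact: integral_ge0.
apply: eq_integral => b _.
apply: (tonelliR (f := fun p => F p.2 s b p.1)%E) => //.
exact: mF'.
Qed.

End sing_integral.

(** * The function [A] along a fixed path, and its inner products *)

Section occupation.
Context {R : realType}.
Local Notation mu := (@lebesgue_measure R).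
Implicit Types (xi : R -> R) (eps delta t s y z : R).

(** This is [Afun] with the randomness frozen: [xi] stands for the shifted path. *)
Definition pathA xi eps delta t : R * R -> R :=
  fun sy => Rintegral mu `[0, t]%classic
    (fun a => psi delta (t - a - sy.1) * heat eps (xi a - sy.2)).

(** [p.1] is a path time and [p.2] a noise time. Carrying both domain restrictions inside the weight
    allows every later integral to run over the whole line. *)
Definition wgt t delta (p : R * R) : R :=
  \1_(`[0, t]%classic) p.1 * \1_(`[0, +oo[%classic) p.2 * psi delta (t - p.1 - p.2).

Lemma psi_ge0 delta u : 0 < delta -> 0 <= psi delta u.
Proof. by move=> d0; rewrite /psi mulr_ge0// invr_ge0 ltW. Qed.

Lemma wgt_ge0 t delta p : 0 < delta -> 0 <= wgt t delta p.
Proof. by move=> d0; rewrite /wgt; apply: mulr_ge0; [exact: mulr_ge0|exact: psi_ge0]. Qed.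

Lemma measurable_psi delta : measurable_fun setT (psi delta).
Proof.
by rewrite /psi; apply: measurable_funM => //; exact: measurable_indic.
Qed.

Lemma measurable_wgt t delta : measurable_fun setT (wgt t delta).
Proof.
rewrite /wgt; apply: measurable_funM; first apply: measurable_funM.
- by apply: measurableT_comp => //; exact: measurable_indic.
- by apply: measurableT_comp => //; exact: measurable_indic.
- apply: (measurableT_comp (measurable_psi delta)).
  by apply: measurable_funB => //; exact: measurable_funB.
Qed.

(** [Rintegral] passes through [fine], so finiteness has to be checked: the integrand is bounded by
    the product of [delta^-1] and [(Num.sqrt eps)^-1] on a bounded interval. *)
Lemma pathA_integral xi eps delta t s y : measurable_fun setT xi -> 0 < delta ->
  (pathA xi eps delta t (s, y))%:E =
  (\int[mu]_a (\1_(`[0, t]%classic) a * psi delta (t - a - s) * heat eps (xi a - y))%:E)%E.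
Proof.
move=> mxi d0.
have mf : measurable_fun setT (fun a : R => psi delta (t - a - s) * heat eps (xi a - y)).
  apply: measurable_funM.
    apply: (measurableT_comp (measurable_psi delta)).
    by apply: measurable_funB => //; exact: measurable_funB.
  by apply: measurable_heat_comp => //; exact: measurable_funB.
have E : (\int[mu]_a (\1_(`[0, t]%classic) a * psi delta (t - a - s) * heat eps (xi a - y))%:E)%E
    = (\int[mu]_(a in `[0%R, t]) (psi delta (t - a - s) * heat eps (xi a - y))%:E)%E.
  rewrite [RHS]integral_mkcond; apply: eq_integral => a _.
  by rewrite patchE indicE; case: ifP => _; rewrite ?mul1r ?mul0r.
rewrite E /pathA /Rintegral/= fineK//.
rewrite ge0_fin_numE; last first.
  by apply: integral_ge0 => a _; rewrite lee_fin mulr_ge0 ?psi_ge0 ?heat_ge0.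
apply: (@le_lt_trans _ _ (\int[mu]_(a in `[0%R, t]) (cst ((delta^-1 * (Num.sqrt eps)^-1)%:E) a))%E).
  apply: ge0_le_integral => //=.
  - by move=> a _; rewrite lee_fin mulr_ge0 ?psi_ge0 ?heat_ge0.
  - by apply/measurable_EFinP; exact: measurable_funTS.
  - move=> a _; rewrite lee_fin ler_pM ?psi_ge0 ?heat_ge0 ?heat_le//.
    rewrite /psi ler_piMr ?invr_ge0 ?(ltW d0)// indicE; by case: (_ \in _).
rewrite integral_cst//= lebesgue_measure_itv/=; case: ifP => _.
  by rewrite -EFinB -EFinM ltry.
by rewrite mule0 ltry.
Qed.

Lemma pathA_wgt xi eps delta t s y : measurable_fun setT xi -> 0 < delta -> 0 <= s ->
  (pathA xi eps delta t (s, y))%:E =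
  (\int[mu]_a (wgt t delta (a, s) * heat eps (xi a - y))%:E)%E.
Proof.
move=> mxi d0 s0; rewrite pathA_integral//; apply: eq_integral => a _.
rewrite /wgt/= [\1_(`[0, +oo[%classic) s]indicE mem_set ?mulr1//=.
by rewrite in_itv/= s0.
Qed.

Lemma pathA_ge0 xi eps delta t p : 0 < delta -> 0 <= pathA xi eps delta t p.
Proof.
move=> d0; rewrite /pathA; apply: Rintegral_ge0 => a _.
by rewrite mulr_ge0 ?psi_ge0 ?heat_ge0.
Qed.

Lemma measurable_pathA xi eps delta t : measurable_fun setT xi -> 0 < delta ->
  measurable_fun setT (pathA xi eps delta t).
Proof.
move=> mxi d0; apply/measurable_EFinP.
pose f (p : (R * R) * R) : \bar R :=
  (\1_(`[0, t]%classic) p.2 * psi delta (t - p.2 - p.1.1) * heat eps (xi p.2 - p.1.2))%:E.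
have mf : measurable_fun setT f.
  apply/measurable_EFinP; apply: measurable_funM; first apply: measurable_funM.
  - by apply: measurableT_comp => //; exact: measurable_indic.
  - apply: (measurableT_comp (measurable_psi delta)).
    apply: measurable_funB => //; first exact: measurable_funB.
    by apply: measurableT_comp.
  - apply: measurable_heat_comp => //; apply: measurable_funB.
      by apply: measurableT_comp.
    by apply: measurableT_comp.
have f0 p : (0 <= f p)%E.
  rewrite lee_fin; apply: mulr_ge0 (heat_ge0 _ _).
  by apply: mulr_ge0 (psi_ge0 _ d0); rewrite indicE.
rewrite (_ : _ \o _ = fubini_F mu f); first exact: measurable_fun_fubini_tonelli_F.
by apply/funext => -[s y]; rewrite /= pathA_integral.
Qed.

Lemma pathA_conv xi eps delta t s tau z : measurable_fun setT xi -> 0 < eps -> 0 < delta ->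
  0 <= s -> 0 < tau ->
  (\int[mu]_y (pathA xi eps delta t (s, y) * heat tau (y - z))%:E =
   \int[mu]_a (wgt t delta (a, s) * heat (eps + tau) (xi a - z))%:E)%E.
Proof.
move=> mxi e0 d0 s0 tau0.
have mw : measurable_fun setT (fun a : R => wgt t delta (a, s)).
  by apply: (measurableT_comp (measurable_wgt t delta)); exact: measurable_fun_pair.
have mh y : measurable_fun setT (fun a : R => heat eps (xi a - y)).
  by apply: measurable_heat_comp => //; exact: measurable_funB.
pose f (p : R * R) : \bar R :=
  (wgt t delta (p.2, s) * heat eps (xi p.2 - p.1) * heat tau (p.1 - z))%:E.
have mf : measurable_fun setT f.
  apply/measurable_EFinP; apply: measurable_funM; first apply: measurable_funM.
  - by apply: (measurableT_comp mw).
  - apply: measurable_heat_comp => //; apply: measurable_funB => //.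
    by apply: measurableT_comp.
  - by apply: measurable_heat_comp => //; exact: measurable_funB.
have f0 p : (0 <= f p)%E.
  by rewrite lee_fin; apply: mulr_ge0 (mulr_ge0 (wgt_ge0 _ _ d0) (heat_ge0 _ _)) (heat_ge0 _ _).
transitivity (\int[mu]_y \int[mu]_a f (y, a))%E.
  apply: eq_integral => y _; rewrite EFinM pathA_wgt// -ge0_integralZr//.
  - by apply/measurable_EFinP; exact: measurable_funM mw (mh y).
  - by move=> a _; rewrite lee_fin; exact: mulr_ge0 (wgt_ge0 _ _ d0) (heat_ge0 _ _).
  - by rewrite lee_fin heat_ge0.
rewrite (tonelliR mf f0); apply: eq_integral => a _.
rewrite /f/=; under eq_integral do rewrite -mulrA EFinM.
rewrite ge0_integralZl//.
- by rewrite heat_conv// EFinM.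
- apply/measurable_EFinP; apply: measurable_funM; apply: measurable_heat_comp => //; exact: measurable_funB.
- by move=> y _; rewrite lee_fin mulr_ge0 ?heat_ge0.
- by rewrite lee_fin wgt_ge0.
Qed.

(* [heat_off (e + e') |r - s|] is the kernel of the inner product; it vanishes at
   [r = s] because [heat 0 = 0] in [Hclass] and [Hip]. *)
Definition heat_off (sig tau z : R) : R := if tau == 0 then 0 else heat (sig + tau) z.

Lemma heat_off_ge0 sig tau z : 0 <= heat_off sig tau z.
Proof. by rewrite /heat_off; case: ifP => // _; exact: heat_ge0. Qed.

Lemma measurable_heat_off d (T : measurableType d) sig (f g : T -> R) :
  measurable_fun setT f -> measurable_fun setT g ->
  measurable_fun setT (fun x => heat_off sig (f x) (g x)).
Proof.
move=> mf mg; apply: measurable_fun_ifT => //; first exact: measurable_fun_eqr.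
by apply: measurable_heat_comp => //; exact: measurable_funD.
Qed.

(** Integrating in [z] raises the time of the kernel from [|r - s|] to [e' + |r - s|], and
    integrating in [y] then adds [e]; each step is one use of [pathA_conv]. *)
Lemma pathA_conv2 xi t e d e' d' s r : measurable_fun setT xi ->
  0 < e -> 0 < d -> 0 < e' -> 0 < d' -> 0 <= s -> 0 <= r ->
  (\int[mu]_y \int[mu]_z (pathA xi e d t (s, y) * pathA xi e' d' t (r, z) *
      heat `|r - s| (y - z))%:E =
   \int[mu]_b \int[mu]_a (wgt t d (a, s) * wgt t d' (b, r) *
      heat_off (e + e') `|r - s| (xi a - xi b))%:E)%E.
Proof.
move=> mxi e0 d0 e'0 d'0 s0 r0.
rewrite /heat_off; have [->|rs] := eqVneq `|r - s| 0.
  rewrite integral0_eq; last first.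
    by move=> y _; rewrite integral0_eq// => z _; rewrite heat0 mulr0.
  rewrite integral0_eq// => b _; rewrite integral0_eq// => a _.
  by rewrite mulr0.
set tau := `|r - s|; have tau0 : 0 < tau by rewrite lt_neqAle eq_sym rs normr_ge0.
have mA := measurable_pathA e t mxi d0.
have mA' := measurable_pathA e' t mxi d'0.
have mAs : measurable_fun setT (fun y : R => pathA xi e d t (s, y)).
  by apply: (measurableT_comp mA); exact: measurable_fun_pair.
have mA'r : measurable_fun setT (fun y : R => pathA xi e' d' t (r, y)).
  by apply: (measurableT_comp mA'); exact: measurable_fun_pair.
have mw' : measurable_fun setT (fun a : R => wgt t d' (a, r)).
  by apply: (measurableT_comp (measurable_wgt t d')); exact: measurable_fun_pair.
have mw : measurable_fun setT (fun a : R => wgt t d (a, s)).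
  by apply: (measurableT_comp (measurable_wgt t d)); exact: measurable_fun_pair.
pose f (p : R * R) : \bar R :=
  (pathA xi e d t (s, p.1) * wgt t d' (p.2, r) * heat (e' + tau) (p.1 - xi p.2))%:E.
have mf : measurable_fun setT f.
  apply/measurable_EFinP; apply: measurable_funM; first apply: measurable_funM.
  - by apply: (measurableT_comp mAs).
  - by apply: (measurableT_comp mw').
  - apply: measurable_heat_comp => //; apply: measurable_funB => //.
    by apply: measurableT_comp.
have f0 p : (0 <= f p)%E.
  rewrite lee_fin; apply: mulr_ge0 (heat_ge0 _ _).
  exact: mulr_ge0 (pathA_ge0 _ _ _ _ d0) (wgt_ge0 _ _ d'0).
transitivity (\int[mu]_y \int[mu]_b f (y, b))%E.
  apply: eq_integral => y _.
  under eq_integral do rewrite -mulrA EFinM -heatN opprB.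
  rewrite ge0_integralZl//; first rewrite pathA_conv//.
  - rewrite -ge0_integralZl//.
    + by apply: eq_integral => b _; rewrite /f/= -EFinM mulrA -[in RHS]heatN opprB.
    + apply/measurable_EFinP; apply: measurable_funM => //.
      by apply: measurable_heat_comp => //; exact: measurable_funB.
    + by move=> b _; rewrite lee_fin; exact: mulr_ge0 (wgt_ge0 _ _ _) (heat_ge0 _ _).
    + by rewrite lee_fin pathA_ge0.
  - apply/measurable_EFinP; apply: measurable_funM => //.
    by apply: measurable_heat_comp => //; exact: measurable_funB.
  - by move=> b _; rewrite lee_fin; exact: mulr_ge0 (pathA_ge0 _ _ _ _ _) (heat_ge0 _ _).
  - by rewrite lee_fin pathA_ge0.
rewrite (tonelliR mf f0); apply: eq_integral => b _.
rewrite /f/=; under eq_integral do rewrite mulrAC mulrC EFinM.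
rewrite ge0_integralZl//; first rewrite pathA_conv// ?addr_gt0//.
- rewrite -ge0_integralZl//.
  + by apply: eq_integral => a _; rewrite -EFinM mulrA addrA; congr (_ * _)%:E; rewrite mulrC.
  + apply/measurable_EFinP; apply: measurable_funM => //.
    by apply: measurable_heat_comp => //; exact: measurable_funB.
  + by move=> a _; rewrite lee_fin; exact: mulr_ge0 (wgt_ge0 _ _ _) (heat_ge0 _ _).
  + by rewrite lee_fin wgt_ge0.
- apply/measurable_EFinP; apply: (measurable_funM mAs).
  by apply: measurable_heat_comp => //; exact: measurable_funB.
- by move=> a _; rewrite lee_fin; exact: mulr_ge0 (pathA_ge0 _ _ _ _ _) (heat_ge0 _ _).
- by rewrite lee_fin wgt_ge0.
Qed.

(** [Hip] before [fine] is applied, so that Tonelli and the comparisons can be carried out before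
    finiteness is known. *)
Definition EHip (f g : R * R -> R) : \bar R :=
  (\int[mu]_(s in [set u : R | (0 <= u)%R]) \int[mu]_(r in [set u : R | (0 <= u)%R])
     \int[mu]_y \int[mu]_z
       (f (s, y) * g (r, z) * heat `|r - s| (y - z))%:E)%E.

Lemma EHip_pathA xi t e d e' d' : measurable_fun setT xi ->
  0 < e -> 0 < d -> 0 < e' -> 0 < d' ->
  EHip (pathA xi e d t) (pathA xi e' d' t) =
  (\int[mu]_a \int[mu]_s \int[mu]_b \int[mu]_r (wgt t d (a, s) * wgt t d' (b, r) *
      heat_off (e + e') `|r - s| (xi a - xi b))%:E)%E.
Proof.
move=> mxi e0 d0 e'0 d'0.
rewrite -(integral_quadruple (F := fun a s b r => (wgt t d (a, s) * wgt t d' (b, r) *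
      heat_off (e + e') `|r - s| (xi a - xi b))%:E)); last 2 first.
- apply/measurable_EFinP; apply: measurable_funM; first apply: measurable_funM.
  + apply: (measurableT_comp (measurable_wgt t d)).
    by apply: measurable_fun_pair; apply: measurableT_comp.
  + apply: (measurableT_comp (measurable_wgt t d')).
    by apply: measurable_fun_pair; apply: measurableT_comp.
  + apply: measurable_heat_off.
      apply: measurableT_comp => //; apply: measurable_funB.
        by apply: measurableT_comp.
      by apply: measurableT_comp.
    apply: measurable_funB.
      by apply: (measurableT_comp mxi); apply: measurableT_comp.
    by apply: (measurableT_comp mxi); apply: measurableT_comp.
- move=> a s b r; rewrite lee_fin; apply: mulr_ge0 (heat_off_ge0 _ _ _).
  exact: mulr_ge0 (wgt_ge0 _ _ d0) (wgt_ge0 _ _ d'0).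
(* The weights vanish at negative noise times, so the integrals over the half-line extend to the
   whole line. *)
have w0 dd a s : ~ 0 <= s -> wgt t dd (a, s) = 0.
  move=> s0; rewrite /wgt/= [\1_(`[0, +oo[%classic) s]indicE memNset ?mulr0 ?mul0r//=.
  by rewrite in_itv/= andbT.
rewrite /EHip integral_mkcond; apply: eq_integral => s _.
rewrite patchE; case: ifPn => [|/negP]; rewrite inE/= => s0; last first.
  rewrite integral0_eq// => r _; rewrite integral0_eq// => b _.
  by rewrite integral0_eq// => a _; rewrite w0// !mul0r.
rewrite integral_mkcond; apply: eq_integral => r _.
rewrite patchE; case: ifPn => [|/negP]; rewrite inE/= => r0; last first.
  rewrite integral0_eq// => b _.
  by rewrite integral0_eq// => a _; rewrite (w0 d' b r r0) mulr0 mul0r.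
exact: pathA_conv2.
Qed.

End occupation.

(** * Measurability, additivity and monotonicity of quadruple integrals *)

Section quadruple_integrals.
Context {R : realType}.
Local Notation mu := (@lebesgue_measure R).

Definition quad (F : R -> R -> R -> R -> \bar R) : \bar R :=
  (\int[mu]_a \int[mu]_s \int[mu]_b \int[mu]_r F a s b r)%E.

Definition qmeas (F : R -> R -> R -> R -> \bar R) : Prop :=
  measurable_fun setT (fun p : ((R * R) * R) * R => F p.1.1.1 p.1.1.2 p.1.2 p.2) /\
  (forall a s b r, (0 <= F a s b r)%E).

Lemma ge0_le_integralT d (T : measurableType d) (m : {measure set T -> \bar R})
    (f g : T -> \bar R) :
  measurable_fun setT f -> measurable_fun setT g ->
  (forall x, (0 <= f x)%E) -> (forall x, (f x <= g x)%E) ->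
  (\int[m]_x f x <= \int[m]_x g x)%E.
Proof. by move=> mf mg f0 fg; apply: ge0_le_integral. Qed.

Lemma qmeas4 F a s b : qmeas F -> measurable_fun setT (F a s b).
Proof.
move=> [mF F0]; apply: (measurableT_comp mF (g := fun r => (((a, s), b), r))).
exact: measurable_fun_pair.
Qed.

Lemma qmeas3 F a s : qmeas F -> measurable_fun setT (fun b => \int[mu]_r F a s b r)%E.
Proof.
move=> [mF F0]; apply: (measurable_integral_pair (f := fun p => F a s p.1 p.2)) => //.
apply: (measurableT_comp mF (g := fun p => (((a, s), p.1), p.2))).
by apply: measurable_fun_pair => //; exact: measurable_fun_pair.
Qed.

Lemma qmeas2 F a : qmeas F ->
  measurable_fun setT (fun s => \int[mu]_b \int[mu]_r F a s b r)%E.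
Proof.
move=> [mF F0].
apply: (measurable_integral_pair (f := fun p => \int[mu]_r F a p.1 p.2 r)%E).
  apply: (measurable_integral_pair (T := (R * R)%type)
    (f := fun p => F a p.1.1 p.1.2 p.2)) => //.
  apply: (measurableT_comp mF (g := fun p : (R * R) * R => (((a, p.1.1), p.1.2), p.2))).
  apply: measurable_fun_pair => //; apply: measurable_fun_pair; last exact: measurableT_comp.
  by apply: measurable_fun_pair => //; exact: measurableT_comp.
by move=> p; exact: integral_ge0.
Qed.

Lemma qmeas1 F : qmeas F ->
  measurable_fun setT (fun a => \int[mu]_s \int[mu]_b \int[mu]_r F a s b r)%E.
Proof.
move=> [mF F0].
apply: (measurable_integral_pair (f := fun p => \int[mu]_b \int[mu]_r F p.1 p.2 b r)%E).
  apply: (measurable_integral_pair (T := (R * R)%type)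
    (f := fun p => \int[mu]_r F p.1.1 p.1.2 p.2 r)%E).
    exact: (measurable_integral_pair (T := ((R * R) * R)%type)
      (f := fun p => F p.1.1.1 p.1.1.2 p.1.2 p.2)).
  by move=> p; exact: integral_ge0.
by move=> p; apply: integral_ge0 => b _; exact: integral_ge0.
Qed.

Lemma qmeasD F G : qmeas F -> qmeas G -> qmeas (fun a s b r => F a s b r + G a s b r)%E.
Proof.
move=> [mF F0] [mG G0]; split; first exact: emeasurable_funD.
by move=> a s b r; rewrite adde_ge0.
Qed.

Lemma quadD F G : qmeas F -> qmeas G ->
  quad (fun a s b r => F a s b r + G a s b r)%E = (quad F + quad G)%E.
Proof.
move=> qF qG; have [_ F0] := qF; have [_ G0] := qG.
rewrite /quad -ge0_integralD//; last 4 first.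
- by move=> a _; do 3 (apply: integral_ge0 => ? _).
- exact: qmeas1.
- by move=> a _; do 3 (apply: integral_ge0 => ? _).
- exact: qmeas1.
apply: eq_integral => a _; rewrite -ge0_integralD//; last 4 first.
- by move=> s _; do 2 (apply: integral_ge0 => ? _).
- exact: qmeas2.
- by move=> s _; do 2 (apply: integral_ge0 => ? _).
- exact: qmeas2.
apply: eq_integral => s _; rewrite -ge0_integralD//; last 4 first.
- by move=> b _; exact: integral_ge0.
- exact: qmeas3.
- by move=> b _; exact: integral_ge0.
- exact: qmeas3.
by apply: eq_integral => b _; rewrite -ge0_integralD//; exact: qmeas4.
Qed.

Lemma le_quad F G : qmeas F -> qmeas G ->
  (forall a s b r, (F a s b r <= G a s b r)%E) -> (quad F <= quad G)%E.
Proof.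
move=> qF qG FG; have [_ F0] := qF.
apply: ge0_le_integralT; [exact: qmeas1|exact: qmeas1| |].
  by move=> a; do 3 (apply: integral_ge0 => ? _).
move=> a; apply: ge0_le_integralT; [exact: qmeas2|exact: qmeas2| |].
  by move=> s; do 2 (apply: integral_ge0 => ? _).
move=> s; apply: ge0_le_integralT; [exact: qmeas3|exact: qmeas3| |].
  by move=> b; apply: integral_ge0.
by move=> b; apply: ge0_le_integralT => //; exact: qmeas4.
Qed.

End quadruple_integrals.

(** * Marginals of the weights *)

Section weights.
Context {R : realType}.
Local Notation mu := (@lebesgue_measure R).
Implicit Types (a b s r t d : R).

Lemma integral_psi d c : 0 < d -> (\int[mu]_s (psi d (c - s))%:E = 1)%E.
Proof.
move=> d0; have mp := @measurable_psi R d.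
have pe x : (0 <= (psi d x)%:E)%E by rewrite lee_fin psi_ge0.
rewrite (ge0_integral_opp (f := fun s => (psi d (c + s))%:E)).
- rewrite (ge0_integral_shift c (f := fun s => (psi d s)%:E))//; last first.
    exact/measurable_EFinP.
  rewrite /psi; under eq_integral do rewrite EFinM.
  rewrite ge0_integralZl//.
  + rewrite integral_indic//= setIT lebesgue_measure_itv/= lte_fin d0.
    by rewrite oppr0 adde0 -EFinM mulVf// gt_eqF.
  + by apply/measurable_EFinP; exact: measurable_indic.
  + by rewrite lee_fin invr_ge0 ltW.
- apply/measurable_EFinP; apply: (measurableT_comp mp).
  exact: measurable_funD.
- by move=> x.
Qed.

Lemma measurable_psi_sub d c : measurable_fun setT (fun s : R => (psi d (c - s))%:E).
Proof.
apply/measurable_EFinP; apply: (measurableT_comp (measurable_psi d)).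
exact: measurable_funB.
Qed.

(** The mass of the mollifier that survives at path time [a]. Its noise times fill
    [[t - a - d, t - a]], so for [0 <= a <= t - d] nothing is lost, and for [a] closer to [t] the
    negative part is cut off. *)
Definition tweight t d a : \bar R := (\int[mu]_s (wgt t d (a, s))%:E)%E.

Lemma measurable_wgtl t d s : measurable_fun setT (fun a => (wgt t d (a, s))%:E).
Proof.
apply/measurable_EFinP; apply: (measurableT_comp (measurable_wgt t d)).
exact: measurable_fun_pair.
Qed.

Lemma measurable_wgtr t d a : measurable_fun setT (fun s => (wgt t d (a, s))%:E).
Proof.
apply/measurable_EFinP; apply: (measurableT_comp (measurable_wgt t d)).
exact: measurable_fun_pair.
Qed.

Lemma tweight_ge0 t d a : 0 < d -> (0 <= tweight t d a)%E.
Proof. by move=> d0; apply: integral_ge0 => s _; rewrite lee_fin wgt_ge0. Qed.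

Lemma measurable_tweight t d : 0 < d -> measurable_fun setT (tweight t d).
Proof.
move=> d0; apply: (measurable_integral_pair (f := fun p => (wgt t d (p.1, p.2))%:E)).
  apply/measurable_EFinP; apply: (measurableT_comp (measurable_wgt t d)).
  exact: measurable_fun_pair.
by move=> p; rewrite lee_fin wgt_ge0.
Qed.

Lemma indic01 (A : set R) a : 0 <= (\1_A a : R) <= 1.
Proof. by rewrite indicE; case: (_ \in _); rewrite ?lexx ler01. Qed.

Lemma tweight_le t d a : 0 < d -> (tweight t d a <= (\1_(`[0%R, t]%classic) a)%:E)%E.
Proof.
move=> d0; have /andP[i0 i1] := indic01 `[0%R, t]%classic a.
rewrite -[leRHS]mule1 -(integral_psi (t - a) d0) -ge0_integralZl//; last 2 first.
- exact: measurable_psi_sub.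
- by move=> s _; rewrite lee_fin psi_ge0.
apply: ge0_le_integralT; first exact: measurable_wgtr.
- by apply: measurable_funeM; exact: measurable_psi_sub.
- by move=> s; rewrite lee_fin wgt_ge0.
- move=> s; rewrite -EFinM lee_fin /wgt/= ler_wpM2r ?psi_ge0//.
  by rewrite ler_piMr//; have /andP[] := indic01 `[0%R, +oo[%classic s.
Qed.

Lemma tweight1 t d a : 0 < d -> 0 <= a <= t - d -> tweight t d a = 1%E.
Proof.
move=> d0 /andP[a0 atd]; rewrite -(integral_psi (t - a) d0).
apply: eq_integral => s _; congr (_%:E); rewrite /wgt/=.
rewrite [\1_(`[0, t]%classic) a]indicE mem_set ?mul1r; last first.
  by rewrite /= in_itv/= a0 (le_trans atd)// gerBl ltW.
have [s0|s0] := leP 0 s.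
  by rewrite indicE mem_set ?mul1r//= in_itv/= s0.
rewrite indicE memNset ?mul0r; last by rewrite /= in_itv/= andbT leNgt s0.
rewrite /psi indicE memNset ?mulr0//= in_itv/= => /andP[_].
by apply/negP; rewrite -ltNge; lra.
Qed.

Lemma wgt_inner_le t d s : 0 < d -> (\int[mu]_a (wgt t d (a, s))%:E <= 1)%E.
Proof.
move=> d0; rewrite -(integral_psi (t - s) d0).
apply: ge0_le_integralT; first exact: measurable_wgtl.
- exact: measurable_psi_sub.
- by move=> a; rewrite lee_fin wgt_ge0.
- move=> a; rewrite lee_fin /wgt/= -addrA [- a + _]addrC addrA.
  by rewrite ler_piMl ?psi_ge0.
Qed.

Lemma integral_indic_itv t : 0 <= t ->
  (\int[mu]_a (\1_(`[0%R, t]%classic) a)%:E = t%:E)%E.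
Proof.
move=> t0; rewrite integral_indic//= setIT lebesgue_measure_itv/= lte_fin.
case: ltP => [_|t0']; first by rewrite oppr0 adde0.
by congr (_%:E); apply/eqP; rewrite eq_le t0 t0'.
Qed.

(** A kernel of the path times alone is constant in the noise times, which therefore integrate out
    to the two marginals. *)
Lemma quad_space t d d' (k : R -> R -> \bar R) : 0 < d -> 0 < d' ->
  measurable_fun setT (fun p : R * R => k p.1 p.2) -> (forall a b, (0 <= k a b)%E) ->
  quad (fun a s b r => (wgt t d (a, s))%:E * ((wgt t d' (b, r))%:E * k a b))%E =
  (\int[mu]_a (tweight t d a * \int[mu]_b (tweight t d' b * k a b)))%E.
Proof.
move=> d0 d'0 mk k0; rewrite /quad; apply: eq_integral => a _.
have mka : measurable_fun setT (k a).
  by apply: (measurableT_comp mk (g := fun b => (a, b))); exact: measurable_fun_pair.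
have mwk : measurable_fun setT (fun b => tweight t d' b * k a b)%E.
  by apply: emeasurable_funM => //; exact: measurable_tweight.
have w0 dd p : 0 < dd -> (0 <= (wgt t dd p)%:E)%E by move=> ?; rewrite lee_fin wgt_ge0.
have wk0 b : (0 <= tweight t d' b * k a b)%E by rewrite mule_ge0// tweight_ge0.
rewrite /tweight -ge0_integralZr//; last 3 first.
- exact: measurable_wgtr.
- by move=> s _; exact: w0.
- by apply: integral_ge0 => b _; exact: wk0.
apply: eq_integral => s _; rewrite -ge0_integralZl//; last 2 first.
- by move=> b _; exact: wk0.
- exact: w0.
apply: eq_integral => b _.
rewrite ge0_integralZl//; last 3 first.
- by apply: emeasurable_funM => //; exact: measurable_wgtr.
- by move=> r _; rewrite mule_ge0// w0.
- exact: w0.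
congr (_ * _)%E; rewrite ge0_integralZr//; first exact: measurable_wgtr.
by move=> r _; exact: w0.
Qed.

Lemma qmeas_wgt t d d' (k : R -> R -> R -> R -> \bar R) : 0 < d -> 0 < d' ->
  qmeas k ->
  qmeas (fun a s b r => (wgt t d (a, s))%:E * ((wgt t d' (b, r))%:E * k a s b r))%E.
Proof.
move=> d0 d'0 [mk k0]; split; last first.
  by move=> a s b r; rewrite !mule_ge0// lee_fin wgt_ge0.
apply: emeasurable_funM.
  apply/measurable_EFinP.
  apply: (measurableT_comp (measurable_wgt t d) (g := fun p : R * R * R * R => (p.1.1.1, p.1.1.2))).
  by apply: measurable_fun_pair; do 2 (apply: measurableT_comp => //).
apply: emeasurable_funM => //; apply/measurable_EFinP.
apply: (measurableT_comp (measurable_wgt t d') (g := fun p : R * R * R * R => (p.1.2, p.2))).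
by apply: measurable_fun_pair => //; apply: measurableT_comp.
Qed.

(** Counterpart of [quad_space] for a kernel of the noise times. After exchanging [b] and [r], the
    weight integrates in [b] to at most 1, leaving the integral of [h s], at most [M]; the remaining
    weight in [s] and [a] has total mass at most [t]. *)
Lemma quad_time_le t d d' (M : R) (h : R -> R -> \bar R) : 0 <= t -> 0 < d -> 0 < d' ->
  measurable_fun setT (fun p : R * R => h p.1 p.2) -> (forall s r, (0 <= h s r)%E) ->
  (forall s, (\int[mu]_r h s r <= M%:E)%E) ->
  (quad (fun a s b r => (wgt t d (a, s))%:E * ((wgt t d' (b, r))%:E * h s r)) <= (t * M)%:E)%E.
Proof.
move=> t0 d0 d'0 mh h0 hM.
have w0 dd p : 0 < dd -> (0 <= (wgt t dd p)%:E)%E by move=> ?; rewrite lee_fin wgt_ge0.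
have mhs s : measurable_fun setT (h s).
  by apply: (measurableT_comp mh (g := fun b => (s, b))); exact: measurable_fun_pair.
have M0 : 0 <= M.
  by rewrite -lee_fin (le_trans _ (hM 0))//; apply: integral_ge0.
have qF : qmeas (fun a s b r => (wgt t d (a, s))%:E * ((wgt t d' (b, r))%:E * h s r))%E.
  apply: (qmeas_wgt t (k := fun a s b r => h s r)) => //; split=> //.
  apply: (measurableT_comp mh (g := fun p : R * R * R * R => (p.1.1.2, p.2))).
  by apply: measurable_fun_pair => //; do 2 (apply: measurableT_comp => //).
have inner s : (\int[mu]_b \int[mu]_r ((wgt t d' (b, r))%:E * h s r) <= M%:E)%E.
  have mf : measurable_fun setT (fun p : R * R => (wgt t d' (p.1, p.2))%:E * h s p.2)%E.
    apply: emeasurable_funM; last by apply: (measurableT_comp (mhs s)).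
    apply/measurable_EFinP; apply: (measurableT_comp (measurable_wgt t d')).
    exact: measurable_fun_pair.
  have f0 (p : R * R) : (0 <= (wgt t d' (p.1, p.2))%:E * h s p.2)%E.
    by rewrite mule_ge0// w0.
  rewrite (tonelliR mf f0)/=; apply: le_trans (hM s).
  apply: ge0_le_integralT => //.
  - apply: (measurable_integral_pair (f := fun p : R * R => (wgt t d' (p.2, p.1))%:E * h s p.1)%E).
      by apply: (measurableT_comp mf (g := fun p : R * R => (p.2, p.1))); exact: measurable_fun_pair.
    by move=> p; rewrite mule_ge0// w0.
  - exact: mhs.
  - by move=> r; apply: integral_ge0 => b _; rewrite mule_ge0// w0.
  - move=> r; rewrite ge0_integralZr//.
    + by rewrite -[leRHS]mul1e lee_wpmul2r// wgt_inner_le.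
    + exact: measurable_wgtl.
    + by move=> b _; exact: w0.
rewrite /quad.
have E1 a s : (\int[mu]_b \int[mu]_r ((wgt t d (a, s))%:E * ((wgt t d' (b, r))%:E * h s r)) =
   (wgt t d (a, s))%:E * \int[mu]_b \int[mu]_r ((wgt t d' (b, r))%:E * h s r))%E.
  rewrite -ge0_integralZl//; last 3 first.
  - apply: (measurable_integral_pair (f := fun p : R * R => (wgt t d' (p.1, p.2))%:E * h s p.2)%E).
      apply: emeasurable_funM; last by apply: (measurableT_comp (mhs s)).
      apply/measurable_EFinP; apply: (measurableT_comp (measurable_wgt t d')).
      exact: measurable_fun_pair.
    by move=> p; rewrite mule_ge0// w0.
  - by move=> b _; apply: integral_ge0 => r _; rewrite mule_ge0// w0.
  - exact: w0.
  apply: eq_integral => b _; rewrite ge0_integralZl//; last 2 first.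
  - by move=> r _; rewrite mule_ge0// w0.
  - exact: w0.
  exact: emeasurable_funM (measurable_wgtr t d' b) (mhs s).
apply: (@le_trans _ _ (\int[mu]_a (M%:E * (\1_(`[0%R, t]%classic) a)%:E))%E).
  apply: ge0_le_integralT; first exact: qmeas1 qF.
  - by apply: measurable_funeM; apply/measurable_EFinP; exact: measurable_indic.
  - by move=> a; do 3 (apply: integral_ge0 => ? _); rewrite !mule_ge0// w0.
  - move=> a; apply: (@le_trans _ _ (\int[mu]_s (M%:E * (wgt t d (a, s))%:E))%E).
      apply: ge0_le_integralT; first exact: qmeas2 qF.
      + by apply: measurable_funeM; exact: measurable_wgtr.
      + by move=> s; do 2 (apply: integral_ge0 => ? _); rewrite !mule_ge0// w0.
      + by move=> s; rewrite E1 muleC lee_wpmul2r// w0.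
    rewrite ge0_integralZl//; last 2 first.
    + exact: measurable_wgtr.
    + by move=> s _; exact: w0.
    by rewrite lee_wpmul2l// tweight_le.
rewrite ge0_integralZl//; last by apply/measurable_EFinP; exact: measurable_indic.
by rewrite integral_indic_itv// -EFinM mulrC.
Qed.

End weights.

(** * Weighted bilinear integrals *)

Section comparison.
Context {R : realType}.
Local Notation mu := (@lebesgue_measure R).
Implicit Types (a b s r t d : R) (u v w : R -> \bar R) (k : R -> R -> \bar R).

Definition wint u v k : \bar R :=
  (\int[mu]_a (u a * \int[mu]_b (v b * k a b)))%E.

Lemma measurable_section k a : measurable_fun setT (fun p : R * R => k p.1 p.2) ->
  measurable_fun setT (k a).
Proof.
move=> mk; apply: (measurableT_comp mk (g := fun b => (a, b))).
exact: measurable_fun_pair.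
Qed.

Lemma measurable_wint_in v k : measurable_fun setT v -> (forall b, (0 <= v b)%E) ->
  measurable_fun setT (fun p : R * R => k p.1 p.2) -> (forall a b, (0 <= k a b)%E) ->
  measurable_fun setT (fun a => \int[mu]_b (v b * k a b))%E.
Proof.
move=> mv v0 mk k0.
apply: (measurable_integral_pair (f := fun p => v p.2 * k p.1 p.2)%E).
  by apply: emeasurable_funM => //; exact: measurableT_comp.
by move=> p; rewrite mule_ge0.
Qed.

Lemma le_wint u v k u' v' k' :
  measurable_fun setT u -> (forall b, (0 <= u b)%E) ->
  measurable_fun setT u' -> (forall b, (u b <= u' b)%E) ->
  measurable_fun setT v -> (forall b, (0 <= v b)%E) ->
  measurable_fun setT v' -> (forall b, (v b <= v' b)%E) ->
  measurable_fun setT (fun p : R * R => k p.1 p.2) -> (forall a b, (0 <= k a b)%E) ->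
  measurable_fun setT (fun p : R * R => k' p.1 p.2) -> (forall a b, (k a b <= k' a b)%E) ->
  (wint u v k <= wint u' v' k')%E.
Proof.
move=> mu_ u0 mu' uu' mv v0 mv' vv' mk k0 mk' kk'.
have u'0 b : (0 <= u' b)%E := le_trans (u0 b) (uu' b).
have v'0 b : (0 <= v' b)%E := le_trans (v0 b) (vv' b).
have k'0 a b : (0 <= k' a b)%E := le_trans (k0 a b) (kk' a b).
apply: ge0_le_integralT.
- by apply: emeasurable_funM => //; exact: measurable_wint_in.
- by apply: emeasurable_funM => //; exact: measurable_wint_in.
- by move=> a; rewrite mule_ge0// integral_ge0// => b _; rewrite mule_ge0.
- move=> a; apply: lee_pmul => //.
    by apply: integral_ge0 => b _; rewrite mule_ge0.
  apply: ge0_le_integralT.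
  + by apply: emeasurable_funM => //; exact: measurable_section.
  + by apply: emeasurable_funM => //; exact: measurable_section.
  + by move=> b; rewrite mule_ge0.
  + by move=> b; exact: lee_pmul.
Qed.

Lemma wintDl u1 u2 v k :
  measurable_fun setT u1 -> (forall b, (0 <= u1 b)%E) ->
  measurable_fun setT u2 -> (forall b, (0 <= u2 b)%E) ->
  measurable_fun setT v -> (forall b, (0 <= v b)%E) ->
  measurable_fun setT (fun p : R * R => k p.1 p.2) -> (forall a b, (0 <= k a b)%E) ->
  wint (fun a => u1 a + u2 a)%E v k = (wint u1 v k + wint u2 v k)%E.
Proof.
move=> m1 u10 m2 u20 mv v0 mk k0.
have I0 a : (0 <= \int[mu]_b (v b * k a b))%E.
  by apply: integral_ge0 => b _; rewrite mule_ge0.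
have mI := measurable_wint_in mv v0 mk k0.
rewrite /wint -ge0_integralD//.
- by apply: eq_integral => a _; rewrite ge0_muleDl.
- by move=> a _; rewrite mule_ge0.
- exact: emeasurable_funM.
- by move=> a _; rewrite mule_ge0.
- exact: emeasurable_funM.
Qed.

Lemma wintDr u v1 v2 k :
  measurable_fun setT u -> (forall b, (0 <= u b)%E) ->
  measurable_fun setT v1 -> (forall b, (0 <= v1 b)%E) ->
  measurable_fun setT v2 -> (forall b, (0 <= v2 b)%E) ->
  measurable_fun setT (fun p : R * R => k p.1 p.2) -> (forall a b, (0 <= k a b)%E) ->
  wint u (fun a => v1 a + v2 a)%E k = (wint u v1 k + wint u v2 k)%E.
Proof.
move=> m u0 m1 v10 m2 v20 mk k0.
have I0 v a : (forall b, (0 <= v b)%E) -> (0 <= \int[mu]_b (v b * k a b))%E.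
  by move=> v0; apply: integral_ge0 => b _; rewrite mule_ge0.
rewrite /wint -ge0_integralD//.
- apply: eq_integral => a _; rewrite -ge0_muleDr ?I0//; congr (_ * _)%E.
  rewrite -ge0_integralD//.
  + by apply: eq_integral => b _; rewrite ge0_muleDl.
  + by move=> b _; rewrite mule_ge0.
  + by apply: emeasurable_funM => //; exact: measurable_section.
  + by move=> b _; rewrite mule_ge0.
  + by apply: emeasurable_funM => //; exact: measurable_section.
- by move=> a _; rewrite mule_ge0// I0.
- by apply: emeasurable_funM => //; exact: measurable_wint_in.
- by move=> a _; rewrite mule_ge0// I0.
- by apply: emeasurable_funM => //; exact: measurable_wint_in.
Qed.

Lemma wintDk u v k1 k2 :
  measurable_fun setT u -> (forall b, (0 <= u b)%E) ->
  measurable_fun setT v -> (forall b, (0 <= v b)%E) ->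
  measurable_fun setT (fun p : R * R => k1 p.1 p.2) -> (forall a b, (0 <= k1 a b)%E) ->
  measurable_fun setT (fun p : R * R => k2 p.1 p.2) -> (forall a b, (0 <= k2 a b)%E) ->
  wint u v (fun a b => k1 a b + k2 a b)%E = (wint u v k1 + wint u v k2)%E.
Proof.
move=> m u0 mv v0 mk1 k10 mk2 k20.
have I0 k a : (forall a b, (0 <= k a b)%E) -> (0 <= \int[mu]_b (v b * k a b))%E.
  by move=> k0; apply: integral_ge0 => b _; rewrite mule_ge0.
rewrite /wint -ge0_integralD//.
- apply: eq_integral => a _; rewrite -ge0_muleDr ?I0//; congr (_ * _)%E.
  rewrite -ge0_integralD//.
  + by apply: eq_integral => b _; rewrite ge0_muleDr.
  + by move=> b _; rewrite mule_ge0.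
  + by apply: emeasurable_funM => //; exact: measurable_section.
  + by move=> b _; rewrite mule_ge0.
  + by apply: emeasurable_funM => //; exact: measurable_section.
- by move=> a _; rewrite mule_ge0// I0.
- by apply: emeasurable_funM => //; exact: measurable_wint_in.
- by move=> a _; rewrite mule_ge0// I0.
- by apply: emeasurable_funM => //; exact: measurable_wint_in.
Qed.

Lemma wintC u v k :
  measurable_fun setT u -> (forall b, (0 <= u b)%E) ->
  measurable_fun setT v -> (forall b, (0 <= v b)%E) ->
  measurable_fun setT (fun p : R * R => k p.1 p.2) -> (forall a b, (0 <= k a b)%E) ->
  wint u v k = wint v u (fun a b => k b a).
Proof.
move=> m u0 mv v0 mk k0; rewrite /wint.
transitivity (\int[mu]_a \int[mu]_b (u a * (v b * k a b)))%E.
  apply: eq_integral => a _; rewrite ge0_integralZl//.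
    by apply: emeasurable_funM => //; exact: measurable_section.
  by move=> b _; rewrite mule_ge0.
rewrite (tonelliR (f := fun p => u p.1 * (v p.2 * k p.1 p.2))%E)/=; last 2 first.
- by do 2 (apply: emeasurable_funM => //; first exact: measurableT_comp).
- by move=> p; rewrite !mule_ge0.
apply: eq_integral => b _.
under eq_integral do rewrite muleCA.
rewrite ge0_integralZl//.
  apply: emeasurable_funM => //.
  apply: (measurableT_comp mk (g := fun a => (a, b))).
  exact: measurable_fun_pair.
by move=> a _; rewrite mule_ge0.
Qed.

(** A Schur-type estimate: since [v <= 1], the inner integral is at most [M] for every [a], and [u]
    has mass at most [m]. *)
Lemma wint_bound u v k (m M : R) : 0 <= M ->
  measurable_fun setT u -> (forall b, (0 <= u b)%E) ->
  measurable_fun setT v -> (forall b, (0 <= v b <= 1)%E) ->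
  measurable_fun setT (fun p : R * R => k p.1 p.2) -> (forall a b, (0 <= k a b)%E) ->
  (\int[mu]_a u a <= m%:E)%E -> (forall a, (\int[mu]_b k a b <= M%:E)%E) ->
  (wint u v k <= (m * M)%:E)%E.
Proof.
move=> M0 m1 u0 mv v01 mk k0 um kM.
have v0 b : (0 <= v b)%E by have /andP[] := v01 b.
apply: (@le_trans _ _ (\int[mu]_a (u a * M%:E)))%E.
  apply: ge0_le_integralT.
  - by apply: emeasurable_funM => //; exact: measurable_wint_in.
  - exact: emeasurable_funM.
  - by move=> a; rewrite mule_ge0// integral_ge0// => b _; rewrite mule_ge0.
  - move=> a; apply: lee_wpmul2l => //; apply: le_trans (kM a).
    have mka := measurable_section a mk.
    apply: ge0_le_integralT => //.
    + exact: emeasurable_funM.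
    + by move=> b; rewrite mule_ge0.
    + by move=> b; rewrite -[leRHS]mul1e lee_wpmul2r//; have /andP[] := v01 b.
by rewrite ge0_integralZr// EFinM lee_wpmul2r.
Qed.

End comparison.

(** * The energy of a path and the pointwise comparison of kernels *)

Section energy.
Context {R : realType}.
Local Notation mu := (@lebesgue_measure R).
Implicit Types (xi : R -> R) (a b s r t d e rho : R).

Definition unitw t a : \bar R := (\1_(`[0%R, t]%classic) a)%:E.

Definition energy xi t : \bar R :=
  (\int[mu]_(s in `[0%R, t]%classic) \int[mu]_(r in `[0%R, t]%classic)
     (heat `|s - r| (xi s - xi r))%:E)%E.

(** The cutoff changes nothing for [a] and [b] in [[0, t]], and it makes the kernel bounded by
    [sing (t + 1) (a - b)] on the whole plane, hence uniformly integrable in [b] whatever the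
    path. *)
Definition heatk t xi a b : \bar R :=
  if `|a - b| < t + 1 then (heat `|a - b| (xi a - xi b))%:E else 0%E.

Lemma unitw01 t a : (0 <= unitw t a <= 1)%E.
Proof. by rewrite !lee_fin indic01. Qed.

Lemma measurable_unitw t : measurable_fun setT (unitw t).
Proof. by apply/measurable_EFinP; exact: measurable_indic. Qed.

Lemma heatk_ge0 t xi a b : (0 <= heatk t xi a b)%E.
Proof. by rewrite /heatk; case: ifP => // _; rewrite lee_fin heat_ge0. Qed.

Lemma measurable_heatk t xi : measurable_fun setT xi ->
  measurable_fun setT (fun p : R * R => heatk t xi p.1 p.2).
Proof.
move=> mxi.
have mab : measurable_fun setT (fun p : R * R => `|p.1 - p.2|).
  by apply: measurableT_comp => //; exact: measurable_funB.
apply: measurable_fun_ifT => //; first exact: measurable_fun_ltr.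
apply/measurable_EFinP; apply: measurable_heat_comp => //.
by apply: measurable_funB; exact: measurableT_comp.
Qed.

Lemma heatk_le_sing t xi a b : (heatk t xi a b <= sing (t + 1) (a - b))%E.
Proof.
rewrite /heatk; case: ltP => ab; last exact: sing_ge0.
by rewrite -(sing_norm _ (a - b)) heat_le_sing// normr_ge0.
Qed.

Lemma heatkE t xi a b : 0 <= a <= t -> 0 <= b <= t ->
  heatk t xi a b = (heat `|a - b| (xi a - xi b))%:E.
Proof.
move=> /andP[a0 at_] /andP[b0 bt]; rewrite /heatk ifT// ltr_norml.
by apply/andP; split; lra.
Qed.

Lemma energyE xi t : energy xi t = wint (unitw t) (unitw t) (heatk t xi).
Proof.
rewrite /energy /wint integral_mkcond; apply: eq_integral => a _.
rewrite patchE /unitw indicE; case: ifPn => [|_]; last by rewrite mul0e.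
rewrite inE/= in_itv/= => at_; rewrite mul1e integral_mkcond.
apply: eq_integral => b _; rewrite patchE indicE.
case: ifPn => [|_]; last by rewrite mul0e.
by rewrite inE/= in_itv/= => bt; rewrite mul1e heatkE.
Qed.

(** The path times at which [tweight t d] may fall below 1. *)
Definition edge t d a : \bar R := (\1_(`](t - d), t]%classic) a)%:E.

Lemma edge01 t d a : (0 <= edge t d a <= 1)%E.
Proof. by rewrite !lee_fin indic01. Qed.

Lemma measurable_edge t d : measurable_fun setT (edge t d).
Proof. by apply/measurable_EFinP; exact: measurable_indic. Qed.

Lemma integral_edge t d : 0 < d -> (\int[mu]_a edge t d a <= d%:E)%E.
Proof.
move=> d0; rewrite integral_indic//= setIT lebesgue_measure_itv/= lte_fin.
by rewrite ltrBlDr ltrDl d0 -EFinB lee_fin; lra.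
Qed.

Lemma unitw_le_tweight t d a : 0 < d -> (unitw t a <= tweight t d a + edge t d a)%E.
Proof.
move=> d0; have w0 := tweight_ge0 t a d0.
have e0 : (0 <= edge t d a)%E by have /andP[] := edge01 t d a.
have [/andP[a0 at_]|at_] := boolP (0 <= a <= t); last first.
  rewrite /unitw indicE memNset/=; first exact: adde_ge0.
  by rewrite in_itv/=; exact/negP.
have /andP[_ u1] := unitw01 t a; apply: (le_trans u1).
have [atd|tda] := leP a (t - d).
  by rewrite tweight1 ?a0// leeDl.
by rewrite /edge indicE mem_set ?leeDr//= in_itv/= tda at_.
Qed.

Lemma sing_sub_measurable rho : measurable_fun setT (fun p : R * R => sing rho (p.1 - p.2)).
Proof. by apply: (measurableT_comp (measurable_sing rho)); exact: measurable_funB. Qed.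

Lemma wint_edge t d xi : 0 <= t -> 0 < d -> measurable_fun setT xi ->
  (wint (edge t d) (unitw t) (heatk t xi) <= (d * (4 * Num.sqrt (t + 1)))%:E)%E.
Proof.
move=> t0 d0 mxi; have t1 : 0 < t + 1 by rewrite ltr_wpDl.
apply: wint_bound.
- by rewrite mulr_ge0// sqrtr_ge0.
- exact: measurable_edge.
- by move=> b; have /andP[] := edge01 t d b.
- exact: measurable_unitw.
- by move=> b; exact: unitw01.
- exact: measurable_heatk.
- by move=> a b; exact: heatk_ge0.
- exact: integral_edge.
- move=> a; apply: le_trans (integral_sing_shift a t1).
  apply: ge0_le_integralT.
  + by apply: measurable_section; exact: measurable_heatk.
  + exact: (measurable_section (k := fun a b => sing (t + 1) (a - b)) a (sing_sub_measurable (t + 1))).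
  + by move=> b; exact: heatk_ge0.
  + by move=> b; exact: heatk_le_sing.
Qed.

Lemma heatkC t xi a b : heatk t xi b a = heatk t xi a b.
Proof. by rewrite /heatk distrC -heatN opprB. Qed.

(** The indicators are replaced by the marginals one at a time. Each replacement loses a strip of
    width [d] or [d'], on which the kernel integrates to at most [4 * Num.sqrt (t + 1)] in the other
    variable; symmetry of [heatk] reduces the second strip to the first. *)
Lemma energy_le_tweight t d d' xi : 0 <= t -> 0 < d -> 0 < d' -> measurable_fun setT xi ->
  (energy xi t <= wint (tweight t d) (tweight t d') (heatk t xi)
    + ((d + d') * (4 * Num.sqrt (t + 1)))%:E)%E.
Proof.
move=> t0 d0 d'0 mxi.
have mk := measurable_heatk t mxi; have k0 := heatk_ge0 t xi.
have mu_ := measurable_unitw t.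
have u0 a : (0 <= unitw t a)%E by have /andP[] := unitw01 t a.
have me dd := measurable_edge t dd.
have e0 dd a : (0 <= edge t dd a)%E by have /andP[] := edge01 t dd a.
have mw := measurable_tweight t d0; have mw' := measurable_tweight t d'0.
have w0 a := tweight_ge0 t a d0; have w'0 a := tweight_ge0 t a d'0.
rewrite energyE.
apply: (@le_trans _ _ (wint (fun a => tweight t d a + edge t d a)%E (unitw t) (heatk t xi))).
  apply: le_wint => //; first exact: emeasurable_funD.
  by move=> a; exact: unitw_le_tweight.
have -> : ((d + d') * (4 * Num.sqrt (t + 1)))%:E =
    ((d' * (4 * Num.sqrt (t + 1)))%:E + (d * (4 * Num.sqrt (t + 1)))%:E)%E.
  by rewrite -EFinD; congr EFin; ring.
have addA_le (x y z p q : \bar R) : (x <= z + p -> y <= q -> x + y <= z + (p + q))%E.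
  by move=> xzp yq; rewrite addeA leeD.
rewrite (wintDl mw w0 (me d) (e0 d) mu_ u0 mk k0).
apply: addA_le; last exact: wint_edge.
apply: (@le_trans _ _ (wint (tweight t d) (fun a => tweight t d' a + edge t d' a)%E (heatk t xi))).
  apply: le_wint => //; first exact: emeasurable_funD.
  by move=> a; exact: unitw_le_tweight.
rewrite (wintDr mw w0 mw' w'0 (me d') (e0 d') mk k0); apply: leeD => //.
apply: (@le_trans _ _ (wint (unitw t) (edge t d') (heatk t xi))).
  by apply: le_wint => // a; exact: tweight_le.
rewrite wintC// (_ : (fun a b => heatk t xi b a) = heatk t xi); first exact: wint_edge.
by do 2 (apply/funext => ?); exact: heatkC.
Qed.

Lemma wint_tweight_le_energy t d d' xi : 0 < d -> 0 < d' -> measurable_fun setT xi ->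
  (wint (tweight t d) (tweight t d') (heatk t xi) <= energy xi t)%E.
Proof.
move=> d0 d'0 mxi; rewrite energyE.
apply: le_wint.
- exact: measurable_tweight.
- by move=> a; exact: tweight_ge0.
- exact: measurable_unitw.
- by move=> a; exact: tweight_le.
- exact: measurable_tweight.
- by move=> a; exact: tweight_ge0.
- exact: measurable_unitw.
- by move=> a; exact: tweight_le.
- exact: measurable_heatk.
- exact: heatk_ge0.
- exact: measurable_heatk.
- by [].
Qed.

Lemma wgt_supp t d a s : wgt t d (a, s) != 0 ->
  [/\ 0 <= a <= t, 0 <= s & 0 <= t - a - s <= d].
Proof.
rewrite /wgt /psi/= !mulf_eq0 !negb_or => /andP[/andP[+ +] /andP[_]].
rewrite !indicE !pnatr_eq0 !eqb0 !negbK !inE/= !in_itv/= andbT.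
by [].
Qed.

(* For [rho] fixed, the first term is small with [eta]; the two others have integrals
   that are small with [rho]. *)
Definition errk t eta rho a s b r : \bar R :=
  (((eta / (rho * Num.sqrt rho))%:E * unitw t b + sing rho (a - b)) + sing rho (r - s))%E.

Lemma errk_ge0 t eta rho a s b r : 0 <= eta -> 0 < rho -> (0 <= errk t eta rho a s b r)%E.
Proof.
move=> eta0 r0; rewrite /errk !adde_ge0 ?sing_ge0// mule_ge0//.
  by rewrite lee_fin divr_ge0// mulr_ge0 ?sqrtr_ge0// ltW.
by have /andP[] := unitw01 t b.
Qed.

(** On the support of the weights, [s] is within [d] of [t - a] and [r] within [d'] of [t - b].
    Hence [|r - s|] and [|a - b|] differ by at most [d + d'], and the two kernel times by at most
    [eta], so that [heat_time_diff] applies in both directions. *)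
Lemma heat_off_le t xi e d d' rho a s b r : 0 < e -> 0 < d -> 0 < d' -> 0 < rho ->
  wgt t d (a, s) != 0 -> wgt t d' (b, r) != 0 ->
  ((heat_off e `|r - s| (xi a - xi b))%:E
     <= heatk t xi a b + errk t (e + d + d') rho a s b r)%E /\
  (heatk t xi a b <= (heat_off e `|r - s| (xi a - xi b))%:E
     + errk t (e + d + d') rho a s b r)%E.
Proof.
move=> e0 d0 d'0 rho0 /wgt_supp[a0t s0 tas] /wgt_supp[b0t r0 tbr].
have ub : unitw t b = 1%E by rewrite /unitw indicE mem_set//= in_itv.
set eta := e + d + d'; have eta0 : 0 <= eta by rewrite !addr_ge0// ltW.
have er0 := errk_ge0 t a s b r eta0 rho0.
have eta_ : `|e + `|r - s| - `|a - b| | <= eta.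
  have : `| `|r - s| - `|a - b| | <= d + d'.
    rewrite (le_trans (ler_dist_dist _ _))//.
    by rewrite ler_norml; apply/andP; split; lra.
  rewrite /eta !ler_norml => /andP[h1 h2]; apply/andP; split; lra.
have sle : (sing rho (e + `|r - s|)%R <= sing rho (r - s)%R)%E.
  apply: le_sing; rewrite [leRHS]ger0_norm ?lerDr ?(ltW e0)//.
  by rewrite addr_ge0// ltW.
have se0 : 0 <= e + `|r - s| by rewrite addr_ge0// ltW.
rewrite (heatkE _ a0t b0t); split.
  rewrite /heat_off; case: ifP => [_|_].
    by rewrite adde_ge0// lee_fin heat_ge0.
  apply: (le_trans (heat_time_diff _ se0 (normr_ge0 (a - b)) rho0 eta_)).
  rewrite leeD2l// /errk ub mule1 sing_norm addeAC leeD2l//.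
(* At [r = s] the value of [heat_off] is 0 and bounds nothing; the error is [+oo] there because
   [sing rho 0] is. *)
have [rs|rs] := eqVneq (r - s) 0.
  rewrite (_ : errk _ _ _ _ _ _ _ = +oo%E) ?addey ?leey//.
  rewrite /errk {2}/sing rs eqxx addey//.
  by rewrite gt_eqF// (@lt_le_trans _ _ 0%E)// adde_ge0 ?sing_ge0// ub mule1 lee_fin divr_ge0// mulr_ge0 ?sqrtr_ge0// ltW.
rewrite /heat_off normr_eq0 (negbTE rs).
rewrite distrC in eta_.
apply: (le_trans (heat_time_diff _ (normr_ge0 (a - b)) se0 rho0 eta_)).
by rewrite leeD2l// /errk ub mule1 sing_norm leeD2l.
Qed.

End energy.

(** * Inner products converge to the energy, uniformly in the path *)

Section approximation.
Context {R : realType}.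
Local Notation mu := (@lebesgue_measure R).
Implicit Types (xi : R -> R) (a b s r t d e rho : R).

Lemma mule_muleDr (x y u v : \bar R) : (0 <= y -> 0 <= u -> 0 <= v ->
  x * (y * (u + v)) = x * (y * u) + x * (y * v))%E.
Proof. by move=> y0 u0 v0; rewrite ge0_muleDr// ge0_muleDr// mule_ge0. Qed.

Lemma qmeas_errk t eta rho : 0 <= eta -> 0 < rho -> qmeas (errk t eta rho).
Proof.
move=> eta0 r0; split; last by move=> a s b r; exact: errk_ge0.
apply: emeasurable_funD; first apply: emeasurable_funD.
- apply: measurable_funeM; apply: (measurableT_comp (measurable_unitw t)).
  exact: measurableT_comp.
- apply: (measurableT_comp (measurable_sing rho)); apply: measurable_funB.
    by do 2 apply: measurableT_comp => //.
  exact: measurableT_comp.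
- apply: (measurableT_comp (measurable_sing rho)); apply: measurable_funB => //.
  by do 2 apply: measurableT_comp => //.
Qed.

(** The constant term and the singularity in [a - b] depend on path times only and go through
    [quad_space]; the singularity in [r - s] goes through [quad_time_le]. The three summands of the
    bound are these contributions, in this order. *)
Lemma quad_errk t d d' eta rho : 0 <= t -> 0 < d -> 0 < d' -> 0 <= eta -> 0 < rho ->
  (quad (fun a s b r => (wgt t d (a, s))%:E *
     ((wgt t d' (b, r))%:E * errk t eta rho a s b r)) <=
   (t * (eta / (rho * Num.sqrt rho) * t) + t * (4 * Num.sqrt rho)
      + t * (4 * Num.sqrt rho))%:E)%E.
Proof.
move=> t0 d0 d'0 eta0 r0.
have c0 : 0 <= eta / (rho * Num.sqrt rho).
  by rewrite divr_ge0// mulr_ge0 ?sqrtr_ge0// ltW.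
have u0 b : (0 <= unitw t b)%E by have /andP[] := unitw01 t b.
have cu0 b : (0 <= (eta / (rho * Num.sqrt rho))%:E * unitw t b)%E by rewrite mule_ge0.
have w0 dd (p : R * R) : 0 < dd -> (0 <= (wgt t dd p)%:E)%E by move=> ?; rewrite lee_fin wgt_ge0.
have s0 x : (0 <= sing rho x)%E by exact: sing_ge0.
have M0 : 0 <= 4 * Num.sqrt rho by rewrite mulr_ge0// sqrtr_ge0.
pose k (a b : R) : \bar R := ((eta / (rho * Num.sqrt rho))%:E * unitw t b + sing rho (a - b)%R)%E.
pose h (s r : R) : \bar R := sing rho (r - s)%R.
have mcu : measurable_fun setT (fun p : R * R => (eta / (rho * Num.sqrt rho))%:E * unitw t p.2)%E.
  apply: measurable_funeM; apply: (measurableT_comp (measurable_unitw t)) => //.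
have msg : measurable_fun setT (fun p : R * R => sing rho (p.1 - p.2)).
  exact: sing_sub_measurable.
have mk : measurable_fun setT (fun p : R * R => k p.1 p.2) by exact: emeasurable_funD.
have mh : measurable_fun setT (fun p : R * R => h p.1 p.2).
  by apply: (measurableT_comp (measurable_sing rho)); exact: measurable_funB.
have k0 a b : (0 <= k a b)%E by rewrite adde_ge0.
have h0 a b : (0 <= h a b)%E by exact: sing_ge0.
have qk : qmeas (fun a s b r => k a b).
  split=> //; apply: (measurableT_comp mk (g := fun p : R * R * R * R => (p.1.1.1, p.1.2))).
  by apply: measurable_fun_pair; [do 2 apply: measurableT_comp => //|apply: measurableT_comp].
have qh : qmeas (fun a s b r => h s r).
  split=> //; apply: (measurableT_comp mh (g := fun p : R * R * R * R => (p.1.1.2, p.2))).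
  by apply: measurable_fun_pair => //; do 2 apply: measurableT_comp => //.
have -> : (fun a s b r => (wgt t d (a, s))%:E *
     ((wgt t d' (b, r))%:E * errk t eta rho a s b r))%E =
   (fun a s b r => (wgt t d (a, s))%:E * ((wgt t d' (b, r))%:E * k a b) +
      (wgt t d (a, s))%:E * ((wgt t d' (b, r))%:E * h s r))%E.
  do 4 (apply/funext => ?).
  exact: (mule_muleDr _ (w0 _ _ d'0) (k0 _ _) (h0 _ _)).
rewrite (quadD (qmeas_wgt t d0 d'0 qk) (qmeas_wgt t d0 d'0 qh)) EFinD; apply: leeD; last first.
  apply: quad_time_le => // s; rewrite /h.
  rewrite (_ : (fun r => sing rho (r - s)) = (fun r => sing rho (s - r))).
    exact: integral_sing_shift.
  by apply/funext => r; rewrite -singN opprB.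
rewrite quad_space//.
apply: (@le_trans _ _ (wint (unitw t) (unitw t) k)).
  apply: le_wint => //.
  - exact: measurable_tweight.
  - by move=> a; exact: tweight_ge0.
  - exact: measurable_unitw.
  - by move=> a; exact: tweight_le.
  - exact: measurable_tweight.
  - by move=> a; exact: tweight_ge0.
  - exact: measurable_unitw.
  - by move=> a; exact: tweight_le.
have mu_ := measurable_unitw t.
have iu : (\int[mu]_a unitw t a = t%:E)%E by exact: integral_indic_itv.
have kD := @wintDk R _ _ (fun a b => (eta / (rho * Num.sqrt rho))%:E * unitw t b)%E
  (fun a b => sing rho (a - b)%R) mu_ u0 mu_ u0 mcu (fun=> cu0) msg (fun a b => s0 _).
rewrite (kD : wint _ _ k = _) EFinD; apply: leeD.
  apply: wint_bound => //.
  - by rewrite mulr_ge0.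
  - by move=> b; exact: unitw01.
  - by rewrite iu.
  - by move=> a; rewrite ge0_integralZl// iu EFinM.
apply: wint_bound => //.
- by move=> b; exact: unitw01.
- by rewrite iu.
- by move=> a; exact: integral_sing_shift.
Qed.

Lemma qmeas_heat_off t xi e : measurable_fun setT xi ->
  qmeas (fun a s b r => (heat_off e `|r - s| (xi a - xi b))%:E).
Proof.
move=> mxi; split; last by move=> a s b r; rewrite lee_fin heat_off_ge0.
apply/measurable_EFinP; apply: measurable_heat_off.
  apply: measurableT_comp => //; apply: measurable_funB => //.
  by do 2 apply: measurableT_comp => //.
apply: measurable_funB.
  by apply: (measurableT_comp mxi); do 2 apply: measurableT_comp => //.
by apply: (measurableT_comp mxi); apply: measurableT_comp.
Qed.

Lemma EHip_energy t xi e d e' d' rho : 0 <= t -> measurable_fun setT xi ->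
  0 < e -> 0 < d -> 0 < e' -> 0 < d' -> 0 < rho ->
  let B := t * ((e + e' + d + d') / (rho * Num.sqrt rho) * t)
      + t * (4 * Num.sqrt rho) + t * (4 * Num.sqrt rho) in
  let h := EHip (pathA xi e d t) (pathA xi e' d' t) in
  (h <= energy xi t + B%:E)%E /\
  (energy xi t <= h + (B + (d + d') * (4 * Num.sqrt (t + 1)))%:E)%E.
Proof.
move=> t0 mxi e0 d0 e'0 d'0 rho0 B h.
have eta0 : 0 <= e + e' + d + d' by rewrite !addr_ge0// ltW.
have ee0 : 0 < e + e' by rewrite addr_gt0.
have qo := qmeas_heat_off t (e + e') mxi.
have qe := qmeas_errk t eta0 rho0.
have qk : qmeas (fun a s b r => heatk t xi a b).
  split; last by move=> *; exact: heatk_ge0.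
  apply: (measurableT_comp (measurable_heatk t mxi) (g := fun p : R * R * R * R => (p.1.1.1, p.1.2))).
  by apply: measurable_fun_pair; [do 2 apply: measurableT_comp => //|apply: measurableT_comp].
have W k := @qmeas_wgt R t d d' k d0 d'0.
have w0 dd (p : R * R) : 0 < dd -> (0 <= (wgt t dd p)%:E)%E by move=> ?; rewrite lee_fin wgt_ge0.
have hE : h = quad (fun a s b r => (wgt t d (a, s))%:E * ((wgt t d' (b, r))%:E *
    (heat_off (e + e') `|r - s| (xi a - xi b))%:E))%E.
  transitivity (quad (fun a s b r => (wgt t d (a, s) * wgt t d' (b, r) *
      heat_off (e + e') `|r - s| (xi a - xi b))%:E)); first exact: EHip_pathA.
  apply: congr1; do 4 (apply/funext => ?).
  exact: (congr1 EFin (esym (mulrA _ _ _))).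
have Wsplit (F G : R -> R -> R -> R -> \bar R) : qmeas F -> qmeas G ->
   (fun a s b r => (wgt t d (a, s))%:E * ((wgt t d' (b, r))%:E * (F a s b r + G a s b r)))%E =
   (fun a s b r => (wgt t d (a, s))%:E * ((wgt t d' (b, r))%:E * F a s b r) +
      (wgt t d (a, s))%:E * ((wgt t d' (b, r))%:E * G a s b r))%E.
  move=> [_ F0] [_ G0].
  do 4 (apply/funext => ?).
  exact: (mule_muleDr _ (w0 _ _ d'0) (F0 _ _ _ _) (G0 _ _ _ _)).
(* The pointwise inequality is required only where both weights are nonzero: elsewhere all products
   are 0, even against an error equal to [+oo]. *)
have key (F G E : R -> R -> R -> R -> \bar R) : qmeas F -> qmeas G -> qmeas E ->
   (forall a s b r, (wgt t d (a, s) != 0)%R -> (wgt t d' (b, r) != 0)%R ->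
      F a s b r <= G a s b r + E a s b r)%E ->
   (quad (fun a s b r => (wgt t d (a, s))%:E * ((wgt t d' (b, r))%:E * F a s b r)) <=
    quad (fun a s b r => (wgt t d (a, s))%:E * ((wgt t d' (b, r))%:E * G a s b r)) +
    quad (fun a s b r => (wgt t d (a, s))%:E * ((wgt t d' (b, r))%:E * E a s b r)))%E.
  move=> qF qG qE FGE; rewrite -(quadD (W _ qG) (W _ qE)) -(Wsplit _ _ qG qE).
  apply: (le_quad (W _ qF) (W _ (qmeasD qG qE))).
  move=> a s b r; have [->|wa] := eqVneq (wgt t d (a, s)) 0; first by rewrite !mul0e.
  have [->|wb] := eqVneq (wgt t d' (b, r)) 0; first by rewrite !mul0e !mule0.
  exact: (lee_wpmul2l (w0 _ _ d0) (lee_wpmul2l (w0 _ _ d'0) (FGE a s b r wa wb))).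
have mk := measurable_heatk t mxi.
have qkE : quad (fun a s b r => (wgt t d (a, s))%:E * ((wgt t d' (b, r))%:E * heatk t xi a b))%E
    = wint (tweight t d) (tweight t d') (heatk t xi).
  exact: (quad_space t d0 d'0 mk (heatk_ge0 t xi)).
have eB := quad_errk t0 d0 d'0 eta0 rho0; split.
  rewrite hE; apply: (le_trans (key _ _ _ qo qk qe _)).
    by move=> a s b r wa wb; have [] := heat_off_le xi ee0 d0 d'0 rho0 wa wb.
  by apply: (leeD _ eB); rewrite qkE; exact: wint_tweight_le_energy.
apply: (le_trans (energy_le_tweight t0 d0 d'0 mxi)).
rewrite EFinD addeA; apply: leeD; last exact: lexx.
rewrite -qkE hE; apply: (le_trans (key _ _ _ qk qo qe _)); last by apply: (leeD _ eB); exact: lexx.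
by move=> a s b r wa wb; have [] := heat_off_le xi ee0 d0 d'0 rho0 wa wb.
Qed.

Lemma energy_ge0 xi t : (0 <= energy xi t)%E.
Proof.
by apply: integral_ge0 => a _; apply: integral_ge0 => b _; rewrite lee_fin heat_ge0.
Qed.

Lemma energy_fin xi t : 0 <= t -> measurable_fun setT xi -> energy xi t \is a fin_num.
Proof.
move=> t0 mxi; have t1 : 0 < t + 1 by rewrite ltr_wpDl.
rewrite ge0_fin_numE ?energy_ge0// energyE.
apply: (@le_lt_trans _ _ (t * (4 * Num.sqrt (t + 1)))%:E); last exact: ltry.
apply: wint_bound.
- by rewrite mulr_ge0// sqrtr_ge0.
- exact: measurable_unitw.
- by move=> b; have /andP[] := unitw01 t b.
- exact: measurable_unitw.
- by move=> b; exact: unitw01.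
- exact: measurable_heatk.
- by move=> a b; exact: heatk_ge0.
- by rewrite integral_indic_itv.
- move=> a; apply: le_trans (integral_sing_shift a t1).
  apply: ge0_le_integralT.
  + by apply: measurable_section; exact: measurable_heatk.
  + exact: (measurable_section (k := fun a b => sing (t + 1) (a - b)) a (sing_sub_measurable (t + 1))).
  + by move=> b; exact: heatk_ge0.
  + by move=> b; exact: heatk_le_sing.
Qed.

Lemma EHip_ge0 t xi e d e' d' : 0 < d -> 0 < d' ->
  (0 <= EHip (pathA xi e d t) (pathA xi e' d' t))%E.
Proof.
move=> d0 d'0; do 4 (apply: integral_ge0 => ? _).
by rewrite lee_fin; apply: mulr_ge0 (mulr_ge0 (pathA_ge0 _ _ _ _ d0) (pathA_ge0 _ _ _ _ d'0)) (heat_ge0 _ _).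
Qed.

Lemma EHip_fin t xi e d e' d' : 0 <= t -> measurable_fun setT xi ->
  0 < e -> 0 < d -> 0 < e' -> 0 < d' ->
  EHip (pathA xi e d t) (pathA xi e' d' t) \is a fin_num.
Proof.
move=> t0 mxi e0 d0 e'0 d'0; rewrite ge0_fin_numE ?EHip_ge0//.
have [h _] := EHip_energy t0 mxi e0 d0 e'0 d'0 (@ltr01 R).
by rewrite (le_lt_trans h)// lte_add_pinfty ?ltry// -ge0_fin_numE ?energy_ge0// energy_fin.
Qed.

Lemma pathA_Hclass xi e d t : 0 <= t -> measurable_fun setT xi -> 0 < e -> 0 < d ->
  Hclass (pathA xi e d t).
Proof.
move=> t0 mxi e0 d0; split; first exact: measurable_pathA.
have A : (fun p => `|pathA xi e d t p|) = pathA xi e d t.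
  by apply/funext => p; rewrite ger0_norm ?pathA_ge0.
change (EHip (fun p => `|pathA xi e d t p|%R) (fun p => `|pathA xi e d t p|%R) < +oo)%E.
by rewrite A -ge0_fin_numE ?EHip_ge0// EHip_fin.
Qed.

(** The threshold [eta] is chosen before the path: the error bounds of [EHip_energy] do not mention
    [xi]. First [rho] makes the singular terms small, then [eta] handles the terms that blow up as
    [rho] tends to 0. *)
Lemma Hip_energy t (eps : R) : 0 < t -> 0 < eps ->
  exists2 eta : R, 0 < eta & forall xi e d e' d', measurable_fun setT xi ->
    0 < e < eta -> 0 < d < eta -> 0 < e' < eta -> 0 < d' < eta ->
    `|Hip (pathA xi e d t) (pathA xi e' d' t) - fine (energy xi t)| <= eps.
Proof.
move=> t0 eps0.
have t1 : 0 < t + 1 by rewrite addr_gt0.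
(* [sr] is the square root of [rho], so that each of the two terms [t * (4 * Num.sqrt rho)] equals
   [eps / 6]. *)
pose sr := eps / (24 * t); have sr0 : 0 < sr by rewrite divr_gt0// mulr_gt0.
pose rho := sr ^+ 2; have rho0 : 0 < rho by rewrite exprn_gt0.
have srE : Num.sqrt rho = sr by rewrite sqrtr_sqr gtr0_norm.
(* [K] collects the terms linear in the scales: four scales in the Lipschitz term, two in the
   strips. With [eta * K = eps / 3] the total error stays below [eps]. *)
pose K := 4 * t * t / (rho * sr) + 8 * Num.sqrt (t + 1).
have K1 : 0 <= 4 * t * t / (rho * sr) by apply: ltW; apply: divr_gt0; [do 2 apply: mulr_gt0 => //|exact: mulr_gt0].
have K2 : 0 < 8 * Num.sqrt (t + 1) by rewrite mulr_gt0// sqrtr_gt0.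
have K0 : 0 < K by rewrite ltr_wpDl.
exists (eps / (3 * K)); first by rewrite divr_gt0// mulr_gt0.
set eta := eps / (3 * K); have etaK : eta * K = eps / 3.
  by rewrite /eta; field; rewrite gt_eqF.
move=> xi e d e' d' mxi /andP[e0 eE] /andP[d0 dE] /andP[e'0 e'E] /andP[d'0 d'E].
have [] := EHip_energy (ltW t0) mxi e0 d0 e'0 d'0 rho0.
have hf := EHip_fin (ltW t0) mxi e0 d0 e'0 d'0.
have ef := energy_fin (ltW t0) mxi.
rewrite /Hip -/(EHip _ _) srE; move: hf ef.
move: (EHip _ _) (energy _ _) => [h| |] [v| |]//= _ _.
rewrite -!EFinD !lee_fin.
have tr0 : 0 <= t * t / (rho * sr) by apply: ltW; apply: divr_gt0; exact: mulr_gt0.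
have r1 : t * (4 * sr) = eps / 6 by rewrite /sr; field; rewrite gt_eqF.
have r2 : t * ((e + e' + d + d') / (rho * sr) * t) <= eta * (4 * t * t / (rho * sr)).
  have -> : t * ((e + e' + d + d') / (rho * sr) * t) = (e + e' + d + d') * (t * t / (rho * sr)) by ring.
  have -> : eta * (4 * t * t / (rho * sr)) = (eta * 4) * (t * t / (rho * sr)) by ring.
  apply: ler_wpM2r => //.
  lra.
have r3 : (d + d') * (4 * Num.sqrt (t + 1)) <= eta * (8 * Num.sqrt (t + 1)).
  have -> : eta * (8 * Num.sqrt (t + 1)) = (eta * 2) * (4 * Num.sqrt (t + 1)) by ring.
  apply: ler_wpM2r; first by rewrite mulr_ge0// sqrtr_ge0.
  lra.
have r4 : eta * (4 * t * t / (rho * sr)) + eta * (8 * Num.sqrt (t + 1)) = eps / 3.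
  by rewrite -mulrDr.
have r5 : 0 <= eta * (8 * Num.sqrt (t + 1)) by apply: le_trans r3; rewrite mulr_ge0 ?mulr_ge0 ?sqrtr_ge0// addr_ge0// ltW.
rewrite r1 => h1 h2; rewrite ler_norml; apply/andP; split; lra.
Qed.

End approximation.

(** * Estimates for the centered normal law *)

Section normal_distribution.
Context {R : realType}.
Local Notation mu := (@lebesgue_measure R).

(** Half of the exponential absorbs [x ^+ 2], by [q * expR (- q) <= 1] with [q = x ^+ 2 / (4 * v)].
    The other half is the density of variance [2 * v], up to a factor [Num.sqrt 2], rounded up to
    2. *)
Lemma normal_second_moment (v : R) : 0 < v ->
  (\int[mu]_x (x ^+ 2 * normal_pdf 0 (Num.sqrt v) x)%:E <= (8 * v)%:E)%E.
Proof.
move=> v0; have v20 : 0 < 2 * v by rewrite mulr_gt0.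
apply: (@le_trans _ _ (\int[mu]_x ((8 * v)%:E * (normal_pdf 0 (Num.sqrt (2 * v)) x)%:E))%E).
  apply: ge0_le_integralT.
  - by apply/measurable_EFinP; apply: measurable_funM; [exact: measurable_funX|exact: measurable_normal_pdf].
  - by apply: measurable_funeM; apply/measurable_EFinP; exact: measurable_normal_pdf.
  - by move=> x; rewrite lee_fin mulr_ge0 ?sqr_ge0 ?normal_pdf_ge0.
  - move=> x; rewrite -EFinM lee_fin -!heatE// /heat.
    have p0 : 0 < 2 * pi * v by rewrite !mulr_gt0 ?pi_gt0.
    have -> : (Num.sqrt (2 * pi * v))^-1 = Num.sqrt 2 * (Num.sqrt (2 * pi * (2 * v)))^-1.
      have -> : 2 * pi * (2 * v) = 2 * (2 * pi * v) by ring.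
      by rewrite (sqrtrM _ (ltW (ltr0Sn _ _))) invfM mulrA mulfV ?mul1r// gt_eqF// sqrtr_gt0.
    have -> : - x ^+ 2 / (2 * v) = - (x ^+ 2 / (4 * v)) - (x ^+ 2 / (4 * v)).
      by field; rewrite gt_eqF.
    have -> : - x ^+ 2 / (2 * (2 * v)) = - (x ^+ 2 / (4 * v)).
      by field; rewrite gt_eqF.
    rewrite expRD; set q := x ^+ 2 / (4 * v).
    have q0 : 0 <= q by rewrite divr_ge0 ?sqr_ge0// mulr_ge0// ltW.
    have qe : q * expR (- q) <= 1.
      rewrite expRN ler_pdivrMr ?expR_gt0// mul1r; have := expR_ge1Dx q; lra.
    have -> : x ^+ 2 = 4 * v * q by rewrite /q; field; rewrite gt_eqF.
    have s2 : Num.sqrt 2 <= 2 :> R.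
      by rewrite -[leRHS](@sqr_sqrtr R)// expr2 ler_peMl// -[leLHS]sqrtr1 ler_sqrt// ler1n.
    set h := (Num.sqrt (2 * pi * (2 * v)))^-1.
    have h0 : 0 <= h by rewrite invr_ge0 sqrtr_ge0.
    have -> : 4 * v * q * (Num.sqrt 2 * h * (expR (- q) * expR (- q))) =
      (Num.sqrt 2 * (q * expR (- q))) * (4 * v * (h * expR (- q))) by ring.
    have -> : 8 * v * (h * expR (- q)) = 2 * (4 * v * (h * expR (- q))) by ring.
    apply: ler_wpM2r.
      by rewrite mulr_ge0 ?mulr_ge0 ?expR_ge0// ltW.
    rewrite -[leRHS]mulr1; apply: ler_pM => //.
    by rewrite mulr_ge0// expR_ge0.
rewrite ge0_integralZl//.
- by rewrite integral_normal_pdf mule1.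
- by apply/measurable_EFinP; exact: measurable_normal_pdf.
- by move=> x _; rewrite lee_fin normal_pdf_ge0.
- by rewrite lee_fin mulr_ge0// ltW.
Qed.

(** The Radon-Nikodym derivative of [normal_prob] and [normal_pdf] have the same integral over every
    measurable set, hence agree almost everywhere. *)
Lemma integral_normal_prob (m s : R) (f : R -> \bar R) :
  measurable_fun setT f -> (forall x, (0 <= f x)%E) ->
  (\int[normal_prob m s]_x f x = \int[mu]_x (f x * (normal_pdf m s x)%:E))%E.
Proof.
move=> mf f0.
pose nu : {finite_measure set (measurableTypeR R) -> \bar R} := normal_prob m s.
have dom : nu `<< mu by exact: normal_prob_dominates.
rewrite -(Radon_Nikodym_SigmaFinite.change_of_variables dom f0 measurableT mf).
have mpdf : measurable_fun setT (fun x => (normal_pdf m s x)%:E).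
  by apply/measurable_EFinP; exact: measurable_normal_pdf.
have RNm := Radon_Nikodym_SigmaFinite.f_integrable dom.
have RNE : ae_eq mu setT (Radon_Nikodym_SigmaFinite.f nu mu) (fun x => (normal_pdf m s x)%:E).
  apply: integral_ae_eq => //.
  by move=> E _ mE; rewrite -(Radon_Nikodym_SigmaFinite.f_integral dom mE).
apply: ge0_ae_eq_integral => //.
- by apply: emeasurable_funM => //; exact: measurable_int RNm.
- exact: emeasurable_funM.
- by move=> x _; rewrite mule_ge0//; exact: Radon_Nikodym_SigmaFinite.f_ge0.
- by move=> x _; rewrite mule_ge0// lee_fin normal_pdf_ge0.
- by apply: filterS RNE => x /= h xT; rewrite h.
Qed.

Definition gmass (v : R) (B : set R) : R := fine (normal_prob 0 (Num.sqrt v) B).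

Lemma gmassE v B : measurable B -> (gmass v B)%:E = normal_prob 0 (Num.sqrt v) B.
Proof.
move=> mB; rewrite /gmass fineK//.
exact: (fin_num_measure (normal_prob 0 (Num.sqrt v) : {finite_measure set (measurableTypeR R) -> \bar R}) B mB).
Qed.

Lemma gmass01 v B : measurable B -> 0 <= gmass v B <= 1.
Proof.
move=> mB; pose nu : probability (measurableTypeR R) R := normal_prob 0 (Num.sqrt v).
rewrite -!lee_fin gmassE//; apply/andP; split; first exact: (measure_ge0 nu).
exact: (@probability_le1 _ _ _ nu).
Qed.

Lemma gmassC v B : measurable B -> gmass v (~` B) = 1 - gmass v B.
Proof.
move=> mB; apply: EFin_inj; rewrite EFinB !gmassE//; last exact: measurableC.
exact: (@probability_setC _ _ _ (normal_prob 0 (Num.sqrt v) : probability (measurableTypeR R) R) B mB).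
Qed.

(** The ratio of the prefactors is exactly [Num.sqrt (s / t)], and the exponential is larger at the
    larger variance. *)
Lemma gmass_le (s t : R) (B : set R) : 0 < s -> s <= t -> measurable B ->
  gmass s B * Num.sqrt (s / t) <= gmass t B.
Proof.
move=> s0 st mB; have t0 := lt_le_trans s0 st.
have mp (v : R) : measurable_fun B (fun x => (normal_pdf 0 (Num.sqrt v) x)%:E).
  by apply/measurable_EFinP; apply: measurable_funTS; exact: measurable_normal_pdf.
have pp (v : R) x : B x -> (0 <= (normal_pdf 0 (Num.sqrt v) x)%:E)%E.
  by move=> _; rewrite lee_fin normal_pdf_ge0.
have r0 : (0 <= (Num.sqrt (s / t))%:E)%E by rewrite lee_fin sqrtr_ge0.
suff le : ((\int[mu]_(x in B) (normal_pdf 0 (Num.sqrt s) x)%:E) * (Num.sqrt (s / t))%:E <=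
    \int[mu]_(x in B) (normal_pdf 0 (Num.sqrt t) x)%:E)%E.
  have gs := gmassE s mB; have gt := gmassE t mB; rewrite /normal_prob in gs gt.
  by rewrite -lee_fin; rewrite -gs -gt -EFinM in le.
rewrite -ge0_integralZr; [|exact: mB|exact: mp|exact: pp|exact: r0].
apply: ge0_le_integral.
- exact: mB.
- by move=> x Bx; apply: mule_ge0 => //; exact: pp.
- by apply: emeasurable_funM; [exact: mp|exact: measurable_cst].
- exact: mp.
- move=> x _; rewrite -EFinM lee_fin -!heatE// /heat mulrAC.
  have p0 : 0 < 2 * pi :> R by rewrite mulr_gt0 ?pi_gt0.
  have -> : (Num.sqrt (2 * pi * s))^-1 * Num.sqrt (s / t) = (Num.sqrt (2 * pi * t))^-1.
    rewrite !(sqrtrM _ (ltW p0)) (sqrtrM _ (ltW s0)) (sqrtrV (ltW t0)).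
    by field; rewrite !gt_eqF// sqrtr_gt0.
  rewrite ler_wpM2l ?invr_ge0 ?sqrtr_ge0// ler_expR !mulNr lerN2 ler_wpM2l ?sqr_ge0//.
  by rewrite lef_pV2 ?posrE ?mulr_gt0// ler_pM2l.
Qed.

(* The density ratio bounds [gmass t] below by a multiple of [gmass s] on a set
   and on its complement, hence the total variation estimate. *)
Lemma gmass_dist (u v : R) (B : set R) : 0 < u -> 0 < v -> measurable B ->
  `|gmass u B - gmass v B| <= `|u - v| / v.
Proof.
have main (s t : R) : 0 < s -> s <= t -> measurable B ->
    `|gmass s B - gmass t B| <= (t - s) / t.
  move=> s0 st mB; have t0 := lt_le_trans s0 st.
  have := gmass_le s0 st mB.
  have := gmass_le s0 st (measurableC mB).
  rewrite (gmassC s mB) (gmassC t mB).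
  have := gmass01 s mB; have := gmass01 t mB.
  move: (gmass s B) (gmass t B) => x y /andP[y0 y1] /andP[x0 x1] h2 h1.
  have q0 : 0 <= s / t by rewrite divr_ge0// ltW.
  have q1 : s / t <= 1 by rewrite ler_pdivrMr// mul1r.
  have r1 : s / t <= Num.sqrt (s / t).
    rewrite -{1}(sqr_sqrtr q0) expr2 ler_piMl ?sqrtr_ge0//.
    by rewrite -[leRHS]sqrtr1 ler_sqrt.
  have r2 : Num.sqrt (s / t) <= 1 by rewrite -[leRHS]sqrtr1 ler_sqrt.
  have -> : (t - s) / t = 1 - s / t by field; rewrite gt_eqF.
  move: (Num.sqrt (s / t)) (s / t) h1 h2 r1 r2 q0 q1 => r q h1 h2 r1 r2 q0 q1.
  by rewrite ler_norml; apply/andP; split; nra.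
move=> u0 v0 mB; have [uv|vu] := leP u v.
  by rewrite [in leRHS]distrC [in leRHS]ger0_norm ?subr_ge0//; exact: main.
have d0 : 0 <= u - v by rewrite subr_ge0 ltW.
rewrite distrC (ger0_norm d0); apply: (le_trans (main v u v0 (ltW vu) mB)).
by rewrite ler_wpM2l// lef_pV2 ?posrE// ltW.
Qed.

(** The density is at most [(Num.sqrt v)^-1], so an interval of length [e] has at most that mass
    times [e]. *)
Lemma gmass_shift (v a e : R) : 0 < v -> 0 <= e ->
  gmass v `]-oo, (a + e)%R[%classic <= gmass v `]-oo, a[%classic + (Num.sqrt v)^-1 * e.
Proof.
move=> v0 e0; pose nu : probability (measurableTypeR R) R := normal_prob 0 (Num.sqrt v).
have -> : `]-oo, (a + e)%R[%classic = `]-oo, a[%classic `|` `[a, (a + e)%R[%classic.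
  apply/seteqP; split => x /=; rewrite !in_itv/=.
    by move=> xae; have [xa|ax] := ltP x a; [left|right; rewrite xae].
  by move=> [xa|/andP[_]//]; rewrite (lt_le_trans xa)// lerDl.
have m1 : measurable (`]-oo, a[%classic : set R) by exact: measurable_itv.
have m2 : measurable (`[a, (a + e)%R[%classic : set R) by exact: measurable_itv.
rewrite -lee_fin EFinD !gmassE//; last exact: measurableU.
apply: (le_trans (@measureU2 _ _ _ nu _ _ m1 m2)); apply: leeD; first exact: lexx.
rewrite /nu/= /normal_prob.
apply: (@le_trans _ _ (\int[mu]_(x in `[a, (a + e)%R[) (cst (Num.sqrt v)^-1%:E x))%E).
  apply: ge0_le_integral.
  - exact: measurable_itv.
  - by move=> x _; rewrite lee_fin normal_pdf_ge0.
  - by apply/measurable_EFinP; apply: measurable_funTS; exact: measurable_normal_pdf.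
  - exact: measurable_cst.
  - by move=> x _; rewrite lee_fin -heatE// heat_le.
rewrite integral_cst//= lebesgue_measure_itv/=; case: ifP => _.
  by rewrite -EFinB -EFinM lee_fin addrAC subrr add0r.
by rewrite mule0 lee_fin mulr_ge0// invr_ge0 sqrtr_ge0.
Qed.

Lemma measure_eq_ray (m1 m2 : probability (measurableTypeR R) R) :
  (forall a : R, m1 `]-oo, a[%classic = m2 `]-oo, a[%classic) ->
  forall A, measurable A -> m1 A = m2 A.
Proof.
move=> m12 A mA.
apply: (@measure_unique _ R (measurableTypeR R) (@RGenInftyO.G R)
  (fun n => `]-oo, (n%:R : R)[%classic) _ _ _ _ m1 m2 _ _ A mA).
- exact: RGenInftyO.measurableE.
- move=> _ _ [x ->] [y ->]; exists (Num.min x y).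
  by apply/seteqP; split => z /=; rewrite !in_itv/= lt_min => /andP.
- by move=> n; exists n%:R.
- apply/seteqP; split => x //= _; exists (truncn `|x|).+1 => //=.
  by rewrite in_itv/= (le_lt_trans (ler_norm x))// truncnS_gt.
- by move=> _ [x ->]; exact: m12.
- move=> n; apply: (@le_lt_trans _ _ 1%E); last exact: ltry.
  exact: probability_le1.
Qed.

End normal_distribution.

(** * Limits in mean square of centered Gaussian variables *)

Section centered_gaussians.
Context {R : realType} d (T : measurableType d) (P : probability T R).
Local Notation mu := (@lebesgue_measure R).
Implicit Types (Y I : T -> R) (u v : R).

Lemma centered_gaussian_second_moment Y v : centered_gaussian P Y v ->
  (\int[P]_w ((Y w) ^+ 2)%:E <= (8 * v)%:E)%E.
Proof.
move=> [v0 [mY lY]].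
have msq : measurable_fun setT (fun x : measurableTypeR R => ((x ^+ 2 : R)%:E)).
  by apply/measurable_EFinP; exact: exprn_measurable.
have sq0 (x : R) : (0 <= (x ^+ 2)%:E)%E by rewrite lee_fin sqr_ge0.
have mY' : measurable_fun setT (Y : T -> measurableTypeR R) by [].
rewrite -(@ge0_integral_pushforward _ _ T (measurableTypeR R) R _ mY' P setT
  (fun x => (x ^+ 2)%:E))//.
move: lY; have [->|vn0] := eqVneq v 0 => lY.
  rewrite (eq_measure_integral (dirac (0 : measurableTypeR R)))//; last first.
    by move=> A mA _; exact: lY.
  by rewrite integral_dirac// expr0n/= mule0 mulr0.
have vp : 0 < v by rewrite lt_neqAle eq_sym vn0.
rewrite (eq_measure_integral (normal_prob 0 (Num.sqrt v)))//; last first.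
  by move=> A mA _; exact: lY.
rewrite integral_normal_prob//.
exact: normal_second_moment.
Qed.

(** Chebyshev's inequality, in real numbers so that it can be fed to linear arithmetic. *)
Lemma second_moment_tail (Z : T -> R) (e m : R) : measurable_fun setT Z -> 0 < e ->
  (\int[P]_w (`|Z w| ^+ 2)%:E <= m%:E)%E ->
  fine (P [set w | e <= `|Z w|]) * e ^+ 2 <= m.
Proof.
move=> mZ e0 Zm.
have mA : measurable [set w | e <= `|Z w|].
  rewrite -[X in measurable X]setTI.
  apply: (@measurable_fun_ler _ _ _ _ (fun=> e) (fun w => `|Z w|) _ _ measurableT [set true]) => //.
  exact: measurableT_comp.
have mZ2 : measurable_fun setT (fun w => (`|Z w| ^+ 2)%:E).
  by apply/measurable_EFinP; apply: measurable_funX; exact: measurableT_comp.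
rewrite -lee_fin EFinM fineK ?fin_num_measure//.
apply: le_trans Zm.
rewrite muleC -integral_cst//.
apply: (@le_trans _ _ (\int[P]_(w in [set w | (e <= `|Z w|)%R]) (`|Z w| ^+ 2)%:E)%E).
  apply: ge0_le_integral => //.
  - by move=> w _; rewrite lee_fin sqr_ge0.
  - exact: measurable_funTS.
  - by move=> w /= ew; rewrite lee_fin lerXn2r// nnegrE ltW.
by apply: ge0_subset_integral => // w _; rewrite lee_fin sqr_ge0.
Qed.

Lemma centered_gaussian0 I : measurable_fun setT I ->
  (\int[P]_w ((I w) ^+ 2)%:E = 0)%E -> centered_gaussian P I 0.
Proof.
move=> mI I20; split=> //; split=> // B mB; rewrite eqxx.
have mP (A : set R) : measurable A -> measurable (I @^-1` A).
  by move=> mA; rewrite -[X in measurable X]setTI; exact: mI.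
have aeI : ae_eq P setT (fun w => ((I w) ^+ 2)%:E) (cst 0%E).
  apply/ae_eq_integral_abs => //.
    by apply/measurable_EFinP; exact: measurable_funX.
  rewrite -[RHS]I20; apply: eq_integral => w _.
  by rewrite gee0_abs// lee_fin sqr_ge0.
have null (A : set R) : measurable A -> ~ A 0 -> P (I @^-1` A) = 0%E.
  move=> mA A0; apply: measure_negligible; first exact: mP.
  apply: negligibleS aeI => w /= Aw h; apply: A0.
  have [/eqP] := h Logic.I; rewrite sqrf_eq0 => /eqP Iw0; rewrite -Iw0.
  exact: Aw.
rewrite diracE; case: (boolP (0 \in B)) => [|/negP] ; rewrite inE => B0; last exact: null.
have := null (~` B) (measurableC mB) (fun h => h B0).
rewrite preimage_setC probability_setC; last exact: mP.
have fB : P (I @^-1` B) \is a fin_num by rewrite fin_num_measure//; exact: mP.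
rewrite -(fineK fB) => -[/eqP]; rewrite subr_eq0 => /eqP p1.
by rewrite -p1.
Qed.

(** The degenerate case is settled by second moments. Otherwise the law of [I] is compared with the
    normal law on rays: off the event [e <= |Y - I|], the event [I < a] lies between [Y < a - e] and
    [Y < a + e]. *)
Lemma centered_gaussian_approx I v : measurable_fun setT I -> 0 <= v ->
  (forall e : R, 0 < e -> exists Y u, [/\ centered_gaussian P Y u, `|u - v| <= e &
     (\int[P]_w (`|Y w - I w| ^+ 2)%:E <= e%:E)%E]) ->
  centered_gaussian P I v.
Proof.
move=> mI v0 approx; split=> //; split=> // B mB.
have mP (f : T -> R) (A : set R) : measurable_fun setT f -> measurable A -> measurable (f @^-1` A).
  by move=> mf mA; rewrite -[X in measurable X]setTI; exact: mf.
have [vE|vn0] := eqVneq v 0.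
  have I20 : (\int[P]_w ((I w) ^+ 2)%:E = 0)%E.
    apply/eqP; rewrite eq_le; apply/andP; split; last first.
      by apply: integral_ge0 => w _; rewrite lee_fin sqr_ge0.
    apply/lee_addgt0Pr => e e0; rewrite add0e.
    (* The square of [I] is at most twice that of [Y] plus twice that of [Y - I]. With [u] and the
       error both at most [e / 18], this integrates to at most [(16 + 2) * (e / 18)]. *)
    have e18 : 0 < e / 18 by rewrite divr_gt0.
    have [Y [u [gY uv YI]]] := approx _ e18.
    have [u0 [mY _]] := gY; rewrite vE subr0 ger0_norm// in uv.
    have m2 := centered_gaussian_second_moment gY.
    apply: (@le_trans _ _ (\int[P]_w (2%:E * ((Y w) ^+ 2)%:E + 2%:E * (`|Y w - I w| ^+ 2)%:E))%E).
      apply: ge0_le_integralT.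
      - by apply/measurable_EFinP; exact: measurable_funX.
      - apply: emeasurable_funD; apply: measurable_funeM; apply/measurable_EFinP; apply: measurable_funX => //.
        by apply: measurableT_comp => //; exact: measurable_funB.
      - by move=> w; rewrite lee_fin sqr_ge0.
      - move=> w; rewrite -!EFinM -EFinD lee_fin real_normK ?num_real//.
        have := sqr_ge0 (2 * Y w - I w); nra.
    have mY2 : measurable_fun setT (fun w => ((Y w) ^+ 2)%:E).
      by apply/measurable_EFinP; exact: measurable_funX.
    have mYI2 : measurable_fun setT (fun w => (`|Y w - I w| ^+ 2)%:E).
      apply/measurable_EFinP; apply: measurable_funX => //.
      by apply: measurableT_comp => //; exact: measurable_funB.
    have sq0 (x : R) : (0 <= (x ^+ 2)%:E)%E by rewrite lee_fin sqr_ge0.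
    have tsq0 (x : R) : (0 <= 2%:E * (x ^+ 2)%:E)%E by rewrite mule_ge0.
    have two0 : (0 <= 2%:E :> \bar R)%E by [].
    rewrite (ge0_integralD _ measurableT (fun w _ => tsq0 (Y w)) (measurable_funeM _ mY2)
      (fun w _ => tsq0 `|Y w - I w|) (measurable_funeM _ mYI2)).
    rewrite (ge0_integralZl _ measurableT mY2 (fun w _ => sq0 (Y w)) two0).
    rewrite (ge0_integralZl _ measurableT mYI2 (fun w _ => sq0 `|Y w - I w|) two0).
    apply: (@le_trans _ _ (2%:E * (8 * u)%:E + 2%:E * (e / 18)%:E)%E).
      by apply: leeD; apply: lee_wpmul2l.
    by rewrite -!EFinM -EFinD lee_fin; lra.
  by have [_ [_ /(_ B mB)]] := centered_gaussian0 mI I20; rewrite eqxx.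
have vp : 0 < v by rewrite lt_neqAle eq_sym vn0.
have mI' : measurable_fun setT (I : T -> measurableTypeR R) by [].
pose X : {mfun T >-> measurableTypeR R} := HB.pack (I : T -> measurableTypeR R)
  (isMeasurableFun.Build _ _ _ _ _ mI').
pose m1 : probability (measurableTypeR R) R := distribution P X.
pose m2 : probability (measurableTypeR R) R := normal_prob 0 (Num.sqrt v).
suff rays a : m1 `]-oo, a[%classic = m2 `]-oo, a[%classic by exact: (measure_eq_ray rays mB).
have mray (b : R) : measurable (`]-oo, b[%classic : set R) by exact: measurable_itv.
transitivity (gmass v `]-oo, a[%classic)%:E; last exact: gmassE.
change (P (I @^-1` `]-oo, a[%classic) = (gmass v `]-oo, a[%classic)%:E).
have pfin : P (I @^-1` `]-oo, a[%classic) \is a fin_num by rewrite fin_num_measure//; exact: mP.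
rewrite -(fineK pfin); congr (_%:E).
set p := fine _; set g := gmass v _.
(* One [e] pays for the change of variance, one for the tail event, and the shift of the ray by [e]
   costs the last term. *)
pose K := 2 + (Num.sqrt v)^-1.
have sv0 : 0 < (Num.sqrt v)^-1 by rewrite invr_gt0 sqrtr_gt0.
have K0 : 0 < K by rewrite addr_gt0.
suff D e : 0 < e -> `|p - g| <= K * e.
  apply/eqP; rewrite -subr_eq0 -normr_le0 leNgt; apply/negP => D0.
  have := D (`|p - g| / (2 * K)); rewrite divr_gt0// ?mulr_gt0// => /(_ isT).
  have -> : K * (`|p - g| / (2 * K)) = `|p - g| / 2 by field; rewrite gt_eqF.
  lra.
(* [e ^+ 3] makes the Chebyshev tail at most [e], [e * v] makes the total variation between
   variances [u] and [v] at most [e], and [v / 2] keeps [u] positive. *)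
move=> e0; pose eps := Num.min (e ^+ 3) (Num.min (e * v) (v / 2)).
have eps0 : 0 < eps by rewrite !lt_min exprn_gt0//= mulr_gt0// divr_gt0.
have [Y [u [[u0 [mY lY]] uv YI]]] := approx _ eps0.
have eps1 : eps <= e ^+ 3 by rewrite /eps ge_min lexx.
have eps2 : eps <= e * v by rewrite /eps !ge_min lexx orbT.
have eps3 : eps <= v / 2 by rewrite /eps !ge_min lexx !orbT.
have up : 0 < u.
  move: uv; rewrite ler_norml => /andP[h1 h2]; lra.
have tv b : `|gmass u `]-oo, b[%classic - gmass v `]-oo, b[%classic| <= e.
  apply: (le_trans (gmass_dist up vp (mray b))).
  by rewrite ler_pdivrMr// (le_trans uv).
have pY b : P (Y @^-1` `]-oo, b[%classic) = (gmass u `]-oo, b[%classic)%:E.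
  by rewrite gmassE// lY//; rewrite gt_eqF.
pose A := [set w | e <= `|Y w - I w|].
have mYI : measurable_fun setT (fun w => Y w - I w) by exact: measurable_funB.
have mA : measurable A.
  rewrite -[X in measurable X]setTI.
  apply: (@measurable_fun_ler _ _ _ _ (fun=> e) (fun w => `|Y w - I w|) _ _ measurableT [set true]) => //.
  exact: measurableT_comp.
have PA : fine (P A) <= e.
  have h : fine (P A) * e ^+ 2 <= eps := second_moment_tail mYI e0 YI.
  have e2 : 0 < e ^+ 2 by rewrite exprn_gt0.
  by rewrite -(ler_pM2r e2) -exprS; exact: le_trans h eps1.
have PAf : P A \is a fin_num by rewrite fin_num_measure.
have up1 : p <= gmass u `]-oo, (a + e)%R[%classic + fine (P A).
  rewrite -lee_fin EFinD -pY (fineK pfin) (fineK PAf).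
  apply: le_trans (measureU2 _ _ _) => //; last exact: mP.
  apply: le_measure; rewrite ?inE; [exact: mP|by apply: measurableU => //; exact: mP|].
  move=> w /=; rewrite in_itv/= => Iw; have [eA|eA] := leP e `|Y w - I w|; first by right.
  left; rewrite in_itv/=; move: eA; rewrite ltr_norml => /andP[]; lra.
have lo1 : gmass u `]-oo, (a - e)%R[%classic <= p + fine (P A).
  rewrite -lee_fin EFinD -pY (fineK pfin) (fineK PAf).
  apply: le_trans (measureU2 _ _ _) => //; last exact: mP.
  apply: le_measure; rewrite ?inE; [exact: mP|by apply: measurableU => //; exact: mP|].
  move=> w /=; rewrite in_itv/= => Iw; have [eA|eA] := leP e `|Y w - I w|; first by right.
  left; rewrite in_itv/=; move: eA; rewrite ltr_norml => /andP[]; lra.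
have s1 := gmass_shift a vp (ltW e0).
have s2 := gmass_shift (a - e) vp (ltW e0); rewrite subrK in s2.
have t1 := tv (a + e); have t2 := tv (a - e).
rewrite -/g in s1 s2.
move: s1 s2 t1 t2 up1 lo1 PA; rewrite !ler_norml /K.
move: (gmass u _) (gmass u _) (gmass v _) (gmass v _) (fine (P A)) => x1 x2 x3 x4 x5.
move=> h1 h2 /andP[h3 h4] /andP[h5 h6] h7 h8 h9.
by rewrite mulrDl; apply/andP; split; lra.
Qed.

End centered_gaussians.

(** * Measurability of right-continuous paths *)

Section right_continuous_paths.
Context {R : realType}.

Lemma measurable_right_continuous (f : R -> R) :
  (forall s, 0 <= s -> f @ at_right s --> f s) ->
  measurable_fun setT (fun s : R => f (Num.max s 0)).
Proof.
move=> rf.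
(* Step functions sampling [f] at the next grid point. The successor puts that point strictly to the
   right of [Num.max s 0], as a limit at the right requires. *)
pose h (n : nat) (s : R) := f ((truncn (n.+1%:R * s)).+1%:R / n.+1%:R).
apply: (measurable_fun_cvg (h := h)) => [n|s _].
- move=> _ B mB; rewrite setTI.
  pose F k := if `[< B (f (k.+1%:R / n.+1%:R)) >]
    then [set s : R | (truncn (n.+1%:R * s))%:R = k%:R :> R] else set0.
  rewrite (_ : _ @^-1` _ = \bigcup_k F k); last first.
    apply/seteqP; split => s /=.
      by move=> Bs; exists (truncn (n.+1%:R * s)) => //; rewrite /F; case: asboolP.
    move=> [k _]; rewrite /F; case: asboolP => // Bk /= /eqP.
    by rewrite eqr_nat /h => /eqP ->.
  apply: bigcup_measurable => k _; rewrite /F; case: ifP => // _.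
  rewrite -[X in measurable X]setTI.
  have : measurable_fun setT (fun s : R => (truncn (n.+1%:R * s))%:R : R).
    apply: nondecreasing_measurable => // x y xy.
    by rewrite ler_nat le_truncn// ler_wpM2l.
  by move=> /(_ measurableT _ (measurable_set1 (k%:R : R))).
- set s' := Num.max s 0.
  have s'0 : 0 <= s' by rewrite /s' le_max lexx orbT.
  (* [truncn] is 0 on negative reals, so for [s < 0] the grid already behaves as at time 0. *)
  have tE n : truncn (n.+1%:R * s) = truncn (n.+1%:R * s').
    rewrite /s'; case: (leP s 0) => // s0; rewrite mulr0 truncn0; apply/truncn0Pn.
    by rewrite -ltNge (le_lt_trans _ ltr01)// mulr_ge0_le0.
  have /cvg_at_rightP := rf s' s'0; apply; split => [n|].
    by rewrite tE ltr_pdivlMr// mulrC truncnS_gt.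
  have inv0 : (fun n : nat => s' + n.+1%:R^-1) @ \oo --> s'.
    rewrite -[X in _ --> X]addr0; apply: cvgD; [exact: cvg_cst|exact: cvg_harmonic].
  apply: (squeeze_cvgr _ (cvg_cst s') inv0); apply: nearW => n.
  rewrite tE; apply/andP; split.
    by rewrite ler_pdivlMr// mulrC ltW// truncnS_gt.
  rewrite ler_pdivrMr// mulrDl mulVf ?pnatr_eq0// -natr1 lerD2r mulrC.
  by have /andP[] := truncn_itv (mulr_ge0 s'0 (ler0n R n.+1)).
Qed.

End right_continuous_paths.

(** * Laws of single values and differences of an isonormal process *)

Section isonormal_processes.
Context {R : realType} d (T : measurableType d) (P : probability T R).
Implicit Types (W : (R * R -> R) -> T -> R) (f g : R * R -> R).

Lemma isonormal_centered W f : isonormal P W -> Hclass f ->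
  centered_gaussian P (W f) (Hip f f).
Proof.
move=> iW Hf; have := iW 1%N (fun=> f) (fun=> 1) (fun=> Hf).
rewrite big_ord1 big_ord1 !mul1r.
by under eq_fun do rewrite big_ord1 mul1r.
Qed.

Lemma isonormal_diff W f g : isonormal P W -> Hclass f -> Hclass g ->
  centered_gaussian P (fun w => W f w - W g w)
    (Hip f f - Hip f g - Hip g f + Hip g g).
Proof.
move=> iW Hf Hg.
pose fs (i : 'I_2) := if i == ord0 then f else g.
pose a (i : 'I_2) : R := if i == ord0 then 1 else -1.
have E (H : (R * R -> R) -> (R * R -> R) -> R) :
    \sum_(i < 2) \sum_(j < 2) a i * a j * H (fs i) (fs j) = H f f - H f g - H g f + H g g.
  rewrite !big_ord_recl !big_ord0 /fs /a /=.
  by move: (H f f) (H f g) (H g f) (H g g) => x y z w; ring.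
have := iW 2%N fs a; rewrite (E Hip).
under eq_fun do rewrite !big_ord_recl big_ord0 /fs /a /= addr0 mul1r mulN1r.
by apply => i; rewrite /fs; case: ifP.
Qed.

End isonormal_processes.

(** * Almost sure convergence of fast Cauchy sequences, and Fatou *)

Section fast_cauchy.
Context {R : realType} d (T : measurableType d) (P : probability T R).

(** The first moments of the increments are at most twice [2 ^- n.+1], hence summable. The sum of
    the absolute increments is then integrable, so finite almost everywhere, and the telescoping
    series converges absolutely there. *)
Lemma ae_cvg_fast (Z : nat -> T -> R) : (forall n, measurable_fun setT (Z n)) ->
  (forall n, (\int[P]_w (`|Z n.+1 w - Z n w| ^+ 2)%:E
     <= (((2 ^ n.+1)%:R^-1) ^+ 2)%:E)%E) ->
  {ae P, forall w, cvgn (Z ^~ w)}.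
Proof.
move=> mZ Zn.
have mD n : measurable_fun setT (fun w => `|Z n.+1 w - Z n w|).
  by apply: measurableT_comp => //; exact: measurable_funB.
have mDE n : measurable_fun setT (fun w => (`|Z n.+1 w - Z n w|)%:E).
  exact/measurable_EFinP.
have mD2 n : measurable_fun setT (fun w => (`|Z n.+1 w - Z n w| ^+ 2)%:E).
  by apply/measurable_EFinP; exact: measurable_funX.
have D1 n : (\int[P]_w (`|Z n.+1 w - Z n w|)%:E <= (2 / (2 ^ (n + 1))%:R)%:E)%E.
  set a : R := (2 ^ n.+1)%:R^-1.
  have a0 : 0 < a by rewrite invr_gt0 ltr0n expn_gt0.
  (* AM-GM bounds the first moment by the second one. *)
  apply: (@le_trans _ _ (\int[P]_w (a%:E + a^-1%:E * (`|Z n.+1 w - Z n w| ^+ 2)%:E))%E).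
    apply: ge0_le_integralT => //.
    - by apply: emeasurable_funD => //; exact: measurable_funeM.
    - move=> w; rewrite -EFinM -EFinD lee_fin.
      set x := `|Z n.+1 w - Z n w|; have x0 : 0 <= x by exact: normr_ge0.
      have -> : a + a^-1 * x ^+ 2 = a^-1 * (a ^+ 2 + x ^+ 2) by field; rewrite gt_eqF.
      rewrite ler_pdivlMl//; nra.
  rewrite ge0_integralD//; last 3 first.
  - by move=> w _; rewrite lee_fin ltW.
  - by move=> w _; rewrite mule_ge0// lee_fin ?invr_ge0 ltW.
  - exact: measurable_funeM.
  have -> : (\int[P]__ a%:E)%E = a%:E.
    by rewrite -[RHS]mule1 -(probability_setT P); exact: integral_cst.
  rewrite ge0_integralZl//; last first.
    by rewrite lee_fin invr_ge0 ltW.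
  apply: (@le_trans _ _ (a%:E + a^-1%:E * (a ^+ 2)%:E)%E).
    apply: leeD => //; apply: lee_wpmul2l; first by rewrite lee_fin invr_ge0 ltW.
    exact: Zn.
  rewrite -EFinM -EFinD lee_fin addn1 -/a.
  have -> : a + a^-1 * a ^+ 2 = 2 * a by field; rewrite gt_eqF.
  exact: lexx.
have S : (\int[P]_w (\sum_(n <oo) (`|Z n.+1 w - Z n w|)%:E) <= 2%:E)%E.
  rewrite integral_nneseries//.
  have := @cvg_geometric_eseries_half R 2 0; rewrite expr0 divr1 => /cvg_lim <- //.
  by apply: lee_nneseries => n _; [move=> _; exact: integral_ge0|exact: D1].
have iS : P.-integrable setT (fun w => \sum_(n <oo) (`|Z n.+1 w - Z n w|)%:E)%E.
  apply/integrableP; split.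
    by apply: ge0_emeasurable_sum => //.
  under eq_integral => w _ do rewrite gee0_abs ?nneseries_ge0//.
  by rewrite (le_lt_trans S)// ltry.
apply: filterS (integrable_ae measurableT iS) => w /(_ Logic.I) fw.
have cs : cvgn (series (telescope (Z ^~ w))).
  apply: normed_cvg; apply: nnseries_is_cvg => //.
    by move=> i; exact: normr_ge0.
  rewrite -ge0_fin_numE; first exact: fw.
  by apply: nneseries_ge0 => n _ _; rewrite lee_fin; exact: normr_ge0.
have -> : Z ^~ w = (fun n => Z 0%N w + series (telescope (Z ^~ w)) n).
  by apply/funext => n; exact: (eq_sum_telescope (Z ^~ w)).
by apply: is_cvgD => //; exact: is_cvg_cst.
Qed.

Lemma le_limn_einf (u : nat -> \bar R) (c : \bar R) : (forall n, (u n <= c)%E) ->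
  (limn_einf u <= c)%E.
Proof.
move=> uc; rewrite limn_einf_lim; apply: lime_le; first exact: is_cvg_einfs.
apply: nearW => n; apply: le_trans (uc n); apply: ereal_inf_lbound.
by exists n => /=.
Qed.

Lemma limn_einf_ge0 (u : nat -> \bar R) : (forall n, (0 <= u n)%E) ->
  (0 <= limn_einf u)%E.
Proof.
move=> u0; rewrite limn_einf_lim; apply: lime_ge; first exact: is_cvg_einfs.
by apply: nearW => n; apply: le_ereal_inf_tmp => _ [m _] <-.
Qed.

(** Fatou's lemma for the sequence started at index [k]: almost everywhere the lower limit of the
    squares is the square at the limit. *)
Lemma second_moment_limit (Z : nat -> T -> R) (Y I : T -> R) (k : nat) (c : R) :
  (forall n, measurable_fun setT (Z n)) -> measurable_fun setT Y ->
  measurable_fun setT I ->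
  {ae P, forall w, Z ^~ w @ \oo --> I w} ->
  (forall n, (k <= n)%N -> (\int[P]_w (`|Y w - Z n w| ^+ 2)%:E <= c%:E)%E) ->
  (\int[P]_w (`|Y w - I w| ^+ 2)%:E <= c%:E)%E.
Proof.
move=> mZ mY mI ZI Yc.
pose f n w := (`|Y w - Z (n + k)%N w| ^+ 2)%:E.
have mf n : measurable_fun setT (f n).
  apply/measurable_EFinP; apply: measurable_funX.
  by apply: measurableT_comp => //; exact: measurable_funB.
have f0 n w : (0 <= f n w)%E by rewrite lee_fin sqr_ge0.
rewrite (_ : (\int[P]_w (`|Y w - I w| ^+ 2)%:E = \int[P]_w limn_einf (f ^~ w))%E).
  apply: le_trans (fatou P measurableT mf (fun n w _ => f0 n w)) _.
  by apply: le_limn_einf => n; apply: Yc; rewrite leq_addl.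
apply: ge0_ae_eq_integral => //.
- apply/measurable_EFinP; apply: measurable_funX.
  by apply: measurableT_comp => //; exact: measurable_funB.
- apply: measurableT_comp => //; apply: measurable_fun_limn_esup => n.
  by apply: measurableT_comp.
- by move=> w _; apply: limn_einf_ge0.
- apply: filterS ZI => w /= cw _.
  have : f ^~ w @ \oo --> (`|Y w - I w| ^+ 2)%:E.
    apply/cvg_EFin; first by apply: nearW.
    rewrite /comp/=.
    have cz : (fun n => Z (n + k)%N w) @ \oo --> I w.
      by move: cw; rewrite -(cvg_shiftn k).
    have cn : (fun n => `|Y w - Z (n + k)%N w|) @ \oo --> `|Y w - I w|.
      by apply: cvg_norm; apply: cvgB => //; exact: cvg_cst.
    by rewrite /f/=; under eq_fun do rewrite expr2; rewrite expr2; exact: cvgM.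
  by move=> /cvg_limn_einf_sup[-> _].
Qed.

End fast_cauchy.

(** The [b]'s are the four inner products in the variance of a difference; their signs cancel the
    common limit [v]. The 8 is the constant of the Gaussian second moment bound. *)
Lemma second_difference_le (R : realType) (b1 b2 b3 b4 v q : R) :
  `|b1 - v| <= q -> `|b2 - v| <= q -> `|b3 - v| <= q -> `|b4 - v| <= q ->
  8 * (b1 - b2 - b3 + b4) <= 32 * q.
Proof.
by rewrite !ler_norml => /andP[? ?] /andP[? ?] /andP[? ?] /andP[? ?]; lra.
Qed.

(** Only path times in [[0, t]] enter, so clamping time at 0 is harmless there, and the clamped path
    is measurable on the whole line. *)
Lemma AfunE (R : realType) (d : measure_display) (T : measurableType d)
    (X : R -> T -> R) (eps delta t x : R) (w : T) :
  Afun X eps delta t x w = pathA (fun s => X (Num.max s 0) w + x) eps delta t.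
Proof.
apply/funext => p; rewrite /Afun /pathA; apply: eq_Rintegral => a.
by rewrite inE/= in_itv/= => /andP[a0 _]; rewrite max_l.
Qed.

(** * Construction of the limit and identification of its conditional law *)

Unset Implicit Arguments.

Theorem theorem3p1 (R : realType)
  (dW : measure_display) (OW : measurableType dW) (PW : probability OW R)
  (dX : measure_display) (OX : measurableType dX) (PX : probability OX R)
  (W : (R * R -> R) -> OW -> R) (X : R -> OX -> R) (alpha c t x : R) :
  0 < alpha <= 2 -> 0 < c -> 0 < t ->
  stable_process PX X alpha c ->
  isonormal PW W ->
  (forall eps delta, 0 < eps -> 0 < delta ->
     measurable_fun setT
       (fun z : OW * OX => W (Afun X eps delta t x z.2) z.1)) ->
  exists I : OW * OX -> R,
    measurable_fun setT I /\
    ((fun ed : R * R =>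
        (\int[(PW \x PX)%E]_z
           (`|W (Afun X ed.1 ed.2 t x z.2) z.1 - I z| ^+ 2)%:E)%E)
       @ filter_prod (0 : R)^'+ (0 : R)^'+ --> 0%E) /\
    {ae PX, forall om : OX,
      exists v : R,
        v%:E = (\int[lebesgue_measure]_(s in `[0%R, t]%classic)
                 \int[lebesgue_measure]_(r in `[0%R, t]%classic)
                   (heat `|s - r| (X s om - X r om))%:E)%E /\
        centered_gaussian PW (fun w => I (w, om)) v}.
Proof.
move=> _ _ t0 [_ [_ [rcX _]]] isoW mWA.
(* Nothing is assumed on [X] at negative times. *)
pose xi om s := X (Num.max s 0) om + x.
have mxi om : measurable_fun setT (xi om).
  apply: measurable_funD => //.
  by apply: (measurable_right_continuous (f := fun s => X s om)) => s s0; exact: rcX.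
have HA om e d : 0 < e -> 0 < d -> Hclass (pathA (xi om) e d t).
  by move=> e0 d0; exact: pathA_Hclass (ltW t0) (mxi om) e0 d0.
pose Y e d (z : OW * OX) := W (Afun X e d t x z.2) z.1.
have YE e d om w : Y e d (w, om) = W (pathA (xi om) e d t) w by rewrite /Y AfunE.
have mY e d : 0 < e -> 0 < d -> measurable_fun setT (Y e d) by exact: mWA.
have mYs e d om : 0 < e -> 0 < d -> measurable_fun setT (fun w => Y e d (w, om)).
  by move=> e0 d0; apply: (measurableT_comp (mY e d e0 d0)); exact: pair2_measurable.
have cauchy (eps : R) : 0 < eps -> exists eta : R, 0 < eta /\
    forall om e d e' d', 0 < e < eta -> 0 < d < eta -> 0 < e' < eta -> 0 < d' < eta ->
    (\int[PW]_w (`|Y e d (w, om) - Y e' d' (w, om)| ^+ 2)%:E <= eps%:E)%E.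
  move=> eps0; have eps32 : 0 < eps / 32 by rewrite divr_gt0.
  have [eta eta0 H] := Hip_energy t0 eps32; exists eta; split=> // om e d e' d' he hd he' hd'.
  have /andP[e0 _] := he; have /andP[d0 _] := hd.
  have /andP[e'0 _] := he'; have /andP[d'0 _] := hd'.
  have g := isonormal_diff isoW (HA om _ _ e0 d0) (HA om _ _ e'0 d'0).
  have h1 := H _ _ _ _ _ (mxi om) he hd he hd.
  have h2 := H _ _ _ _ _ (mxi om) he hd he' hd'.
  have h3 := H _ _ _ _ _ (mxi om) he' hd' he hd.
  have h4 := H _ _ _ _ _ (mxi om) he' hd' he' hd'.
  rewrite (_ : (\int[PW]_w (`|Y e d (w, om) - Y e' d' (w, om)| ^+ 2)%:E)%E =
    (\int[PW]_w ((W (pathA (xi om) e d t) w - W (pathA (xi om) e' d' t) w) ^+ 2)%:E)%E); last first.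
    by apply: eq_integral => w _; rewrite !YE real_normK// num_real.
  apply: (le_trans (centered_gaussian_second_moment g)); rewrite lee_fin.
  by apply: (le_trans (second_difference_le h1 h2 h3 h4)); rewrite mulrC divfK.
(* The rate required by [ae_cvg_fast]. *)
pose tol n : R := ((2 ^ n.+1)%:R^-1) ^+ 2.
have tol0 n : 0 < tol n by rewrite exprn_gt0// invr_gt0 ltr0n expn_gt0.
have [eta /all_and2 [eta0 etaP]] := choice (fun n => cauchy (tol n) (tol0 n)).
(* The running minimum makes [en] nonincreasing, so from index [n] on every scale is below [eta n];
   this serves consecutive differences as well as the comparison with all later terms. *)
pose en := fix f n := if n is m.+1 then Num.min (f m) (eta n / 2) else eta 0%N / 2.
have en0 n : 0 < en n.
  elim: n => [|n IH] /=; first by rewrite divr_gt0.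
  by rewrite lt_min IH divr_gt0.
have en_eta n : en n < eta n.
  have h : eta n / 2 < eta n by rewrite ltr_pdivrMr// ltr_pMr// ltr1n.
  by case: n h => [|n] h //=; rewrite gt_min h orbT.
have en_le n m : (n <= m)%N -> en m <= en n.
  move=> /subnK <-; elim: (m - n)%N => [|k IH]; first exact: lexx.
  by rewrite addSn /= ge_min IH.
have en_lt n m : (n <= m)%N -> 0 < en m < eta n.
  by move=> nm; rewrite en0/= (le_lt_trans (en_le n m nm)).
pose Z n := Y (en n) (en n).
have mZ n : measurable_fun setT (Z n) by exact: mY.
(* An upper limit is jointly measurable without any description of the set of convergence; [fine]
   gives it a real value everywhere. *)
pose I z := fine (limn_esup (fun n => (Z n z)%:E)).
have mI : measurable_fun setT I.
  apply: (measurableT_comp (fine_measurable measurableT)).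
  by apply: measurable_fun_limn_esup => n; exact/measurable_EFinP.
have mIs om : measurable_fun setT (fun w => I (w, om)).
  by apply: (measurableT_comp mI); exact: pair2_measurable.
(* The exceptional null set depends on [om], the subsequence does not. *)
have ZI om : {ae PW, forall w, (fun n => Z n (w, om)) @ \oo --> I (w, om)}.
  have := @ae_cvg_fast R _ OW PW (fun n w => Z n (w, om)) (fun n => mYs _ _ om (en0 n) (en0 n)).
  move=> /(_ (fun n => etaP n om _ _ _ _ (en_lt n n.+1 (leqnSn n)) (en_lt n n.+1 (leqnSn n))
    (en_lt n n (leqnn n)) (en_lt n n (leqnn n)))).
  apply: filterS => w /cvg_ex[l cl]; rewrite /I.
  have cE : (fun n => (Z n (w, om))%:E) @ \oo --> l%:E by apply: cvg_comp cl _.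
  by have [_ ->] := cvg_limn_einf_sup cE.
have L2 (eps : R) : 0 < eps -> exists eta : R, 0 < eta /\
    forall om e d, 0 < e < eta -> 0 < d < eta ->
    (\int[PW]_w (`|Y e d (w, om) - I (w, om)| ^+ 2)%:E <= eps%:E)%E.
  (* [2 ^ n.+1] exceeds [n.+1], which exceeds [eps^-1]; squaring a number at most 1 only decreases
     it. *)
  move=> eps0; pose n := truncn eps^-1.
  have tn : tol n <= eps.
    have h1 : (2 ^ n.+1)%:R^-1 <= eps.
      rewrite -[leRHS]invrK lef_pV2 ?posrE ?invr_gt0 ?ltr0n ?expn_gt0//.
      rewrite (le_trans (ltW (truncnS_gt _)))// ler_nat.
      by rewrite ltnW// ltn_expl.
    have h2 : (2 ^ n.+1)%:R^-1 <= 1 :> R by rewrite invf_le1 ?ltr0n ?expn_gt0// ler1n expn_gt0.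
    have h0 : 0 <= (2 ^ n.+1)%:R^-1 :> R by rewrite invr_ge0.
    by rewrite /tol expr2 (le_trans _ h1)// ler_piMl.
  exists (eta n); split=> // om e d he hd.
  have /andP[e0 _] := he; have /andP[d0 _] := hd.
  apply: (@le_trans _ _ (tol n)%:E); last by rewrite lee_fin.
  apply: (second_moment_limit (Z := fun n w => Z n (w, om)) (k := n)) => //.
  - by move=> m; exact: mYs.
  - exact: mYs.
  - by move=> m nm; apply: etaP => //; exact: en_lt.
exists I; split=> //; split.
- apply/fine_cvgP.
  have near_le (eps : R) : 0 < eps ->
      \forall ed \near filter_prod (0 : R)^'+ (0 : R)^'+,
      (0 <= \int[(PW \x PX)%E]_z (`|W (Afun X ed.1 ed.2 t x z.2) z.1 - I z| ^+ 2)%:E <= eps%:E)%E.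
    move=> eps0; have [h [h0 H]] := L2 _ eps0.
    exists ([set e | 0 < e < h], [set e | 0 < e < h]) => /=.
      by split; near=> e; apply/andP; split; near: e; [exact: nbhs_right_gt|exact: nbhs_right_lt|exact: nbhs_right_gt|exact: nbhs_right_lt].
    move=> [e d] /= [he hd]; have /andP[e0 _] := he; have /andP[d0 _] := hd.
    apply/andP; split; first by apply: integral_ge0 => z _; rewrite lee_fin sqr_ge0.
    have mF : measurable_fun setT (fun z : OW * OX => (`|Y e d z - I z| ^+ 2)%:E).
      apply/measurable_EFinP; apply: measurable_funX; apply: measurableT_comp => //.
      by apply: measurable_funB => //; exact: mY.
    have F0 z : (0 <= (`|Y e d z - I z| ^+ 2)%:E)%E by rewrite lee_fin sqr_ge0.
    (* The order with the path outermost is chosen so that the bound uniform in [om] is merely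
       averaged by [PX]. *)
    rewrite (fubini_tonelli2 (fun z : OW * OX => (`|Y e d z - I z| ^+ 2)%:E) mF F0).
    apply: (@le_trans _ _ (\int[PX]_om (cst eps%:E om))%E).
      apply: ge0_le_integralT => //.
      + exact: measurable_fun_fubini_tonelli_G.
      + by move=> om; exact: integral_ge0.
      + by move=> om; exact: H.
    rewrite (_ : (\int[PX]_om cst eps%:E om)%E = eps%:E)//.
    by rewrite -[RHS]mule1 -(probability_setT PX); exact: integral_cst.
  split.
    apply: filterS (near_le 1 ltr01) => ed /andP[F0 F1].
    by rewrite ge0_fin_numE// (le_lt_trans F1)// ltry.
  apply/cvgrPdist_le => eps eps0; apply: filterS (near_le eps eps0) => ed /= /andP[F0 F1].
  rewrite sub0r normrN ger0_norm ?fine_ge0// -lee_fin fineK//.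
  by rewrite ge0_fin_numE// (le_lt_trans F1)// ltry.
(* The conditional law is identified for every path. The starting point [x] cancels in the
   differences of [xi om]. *)
- apply: aeW => om; exists (fine (energy (xi om) t)).
  rewrite fineK; last exact: energy_fin (ltW t0) (mxi om).
  split.
    apply: eq_integral => s; rewrite inE/= in_itv/= => /andP[s0 _].
    apply: eq_integral => r; rewrite inE/= in_itv/= => /andP[r0 _].
    by rewrite /xi !max_l// opprD addrACA subrr addr0.
  apply: centered_gaussian_approx => //.
    by rewrite fine_ge0// energy_ge0.
  move=> e e0; have [h1 h10 H1] := Hip_energy t0 e0; have [h2 [h20 H2]] := L2 _ e0.
  (* One common scale for [eps] and [delta], at which the variance and the mean square distance to
     [I] are both controlled. *)
  pose a := Num.min h1 h2 / 2.
  have m0 : 0 < Num.min h1 h2 by rewrite lt_min h10.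
  have a0 : 0 < a by rewrite divr_gt0.
  have am : a < Num.min h1 h2 by rewrite ltr_pdivrMr// ltr_pMr// ltr1n.
  have a1 : 0 < a < h1 by rewrite a0 (lt_le_trans am)// ge_min lexx.
  have a2 : 0 < a < h2 by rewrite a0 (lt_le_trans am)// ge_min lexx orbT.
  exists (W (pathA (xi om) a a t)), (Hip (pathA (xi om) a a t) (pathA (xi om) a a t)); split.
  + exact: isonormal_centered isoW (HA om a a a0 a0).
  + exact: H1.
  + apply: le_trans (H2 om a a a2 a2); rewrite le_eqVlt; apply/orP; left; apply/eqP.
    by apply: eq_integral => w _; rewrite YE.
Unshelve. all: by end_near. Qed.
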